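(* Assume $K<\infty$. For every $(u,\gamma)\in BV(a,b)\times\mathcal M(a,b)$ with $\|u\|_{L^\infty}\le K$, $\gamma=D^su+g\mathcal L^1$, $g\in L^1(a,b)$, $u'-g\in L^2(a,b)$, one has $E''(u,\gamma)\le E(u,\gamma)$.
   Context: Fix $0<a<b<\infty$, $c_0>0$, $K\in(0,\infty)$; $f(t)=c_0\min\{t,1\}$; $I_\varepsilon(x)=(x-\varepsilon,x+\varepsilon)$; $\fint_Bh=\frac1{|B|}\int_Bh$. Flat norm $\|\mu\|_{\rm flat}=\sup\{\int\varphi\,d\mu:\varphi\in W^{1,\infty}_0(a,b),\|\varphi\|_{W^{1,\infty}}\le1\}$. For $u\in BV(a,b)$: $Du=u'\mathcal L^1+D^su$, $D^su=[u]\mathcal H^0\llcorner J_u+D^cu$. $E_\varepsilon(u,\gamma)=\int_a^b|u'-g|^2dx+\frac1\varepsilon\int_a^bf\big(\varepsilon\fint_{I_\varepsilon(x)\cap(a,b)}|g|dt\big)dx$ if $u\in W^{1,1}(a,b)$, $\|u\|_{L^\infty}\le K$, $\gamma=g\mathcal L^1$, $g\in L^1$, $u'-g\in L^2$; $+\infty$ otherwise. $E''(u,\gamma)=\inf\{\limsup_{\varepsilon\to0}E_\varepsilon(u_\varepsilon,\gamma_\varepsilon):u_\varepsilon\to u\text{ in }L^1,\ \|\gamma_\varepsilon-\gamma\|_{\rm flat}\to0\}$. $E(u,\gamma)=\int_a^b|u'-g|^2+c_0\int_a^b|g|+2\sum_{x\in J_u}f(\frac12|[u](x)|)+c_0|D^cu|(a,b)$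 if $u\in BV$, $\|u\|_\infty\le K$, $\gamma=D^su+g\mathcal L^1$, $g\in L^1$, $u'-g\in L^2$; $+\infty$ otherwise. *)

(* Defs.v *)
From HB Require Import structures.
From mathcomp Require Import all_boot all_order all_algebra.
From mathcomp Require Import all_classical all_reals all_analysis.
Set Implicit Arguments. Unset Strict Implicit. Unset Printing Implicit Defensive.
Import Order.TTheory GRing.Theory Num.Theory.
Import numFieldNormedType.Exports.
Local Open Scope classical_set_scope.
Local Open Scope ring_scope.

Section defs.
Context {R : realType}.
Notation mu := (@lebesgue_measure R).
Local Open Scope ereal_scope.

(** Finite signed (Borel) measures on R; elements of M(a,b) are those
    concentrated on (a,b). *)
Definition sm := {charge set (measurableTypeR R) -> \bar R}.

Definition hahnP (nu : sm) : set R := projT1 (cid (Hahn_decomposition nu)).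
Definition hahnN (nu : sm) : set R :=
  projT1 (cid (projT2 (cid (Hahn_decomposition nu)))).
Definition hahnH (nu : sm) : hahn_decomposition nu (hahnP nu) (hahnN nu) :=
  projT2 (cid (projT2 (cid (Hahn_decomposition nu)))).

Definition cint (nu : sm) (D : set R) (phi : R -> R) : \bar R :=
  \int[jordan_pos (hahnH nu)]_(x in D) (phi x)%:E
  - \int[jordan_neg (hahnH nu)]_(x in D) (phi x)%:E.

Variables (a b : R).
Definition I : set R := `]a, b[%classic.

Definition concentrated (nu : set R -> \bar R) :=
  forall A : set R, measurable A -> nu A = nu (A `&` I).

Definition test_fun (phi : R -> R) :=
  (forall x, derivable phi x 1) /\ continuous (derive1 phi) /\
  exists c d, (a < c)%R /\ (d < b)%R /\
    forall x, (x < c)%R \/ (d < x)%R -> phi x = 0%R.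

Definition Linf_bd (u : R -> R) (K : R) :=
  {ae mu, forall x, I x -> (`|u x| <= K)%R}.

Definition L1 (h : R -> R) := mu.-integrable I (EFin \o h).

Definition L2 (h : R -> R) :=
  measurable_fun I h /\ \int[mu]_(x in I) ((h x) ^+ 2)%:E < +oo.

Definition W11 (u u' : R -> R) :=
  L1 u /\ L1 u' /\
  forall phi, test_fun phi ->
    \int[mu]_(x in I) (u x * (derive1 phi) x)%:E
    = - \int[mu]_(x in I) (u' x * phi x)%:E.

Definition BVder (u : R -> R) (Du : sm) :=
  L1 u /\ concentrated Du /\
  forall phi, test_fun phi ->
    \int[mu]_(x in I) (u x * (derive1 phi) x)%:E = - cint Du I phi.

Definition lebdec (Du : sm) (u' : R -> R) (Ds : sm) :=
  L1 u' /\ concentrated Ds /\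
  (exists N : set R, measurable N /\ mu N = 0 /\
     forall A : set R, measurable A -> Ds A = Ds (A `&` N)) /\
  forall A : set R, measurable A ->
    Du A = \int[mu]_(x in A `&` I) (u' x)%:E + Ds A.

(** jump set J_u: atoms of Du in (a,b); [u](x) = Du({x}) *)
Definition jumpset (Du : sm) : set R := [set x | I x /\ Du [set x] != 0].

Definition cantor_part (Du Ds : sm) (A : set R) : \bar R :=
  Ds (A `\` jumpset Du).

Definition tv (nu : set R -> \bar R) (D : set R) : \bar R :=
  ereal_sup [set s | exists (n : nat) (A : nat -> set R),
    (forall i, measurable (A i) /\ A i `<=` D) /\
    (forall i j, i != j -> A i `&` A j = set0) /\
    s = \sum_(i < n) `|nu (A i)|].

Variables (K c0 : R).

Definition fc (t : R) : R := (c0 * Num.min t 1)%R.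

Definition Ieps (eps x : R) : set R := `](x - eps)%R, (x + eps)%R[%classic.

Definition avg (eps : R) (g : R -> R) (x : R) : R :=
  (fine (\int[mu]_(t in Ieps eps x `&` I) (`|g t|)%:E)
   / fine (mu (Ieps eps x `&` I)))%R.

(** E_eps(u, gamma) (+oo when no admissible representation exists) *)
Definition Eeps (eps : R) (u : R -> R) (gamma : sm) : \bar R :=
  ereal_inf [set v | exists u' g : R -> R,
    W11 u u' /\ Linf_bd u K /\ L1 g /\
    (forall A : set R, measurable A ->
       gamma A = \int[mu]_(x in A `&` I) (g x)%:E) /\
    L2 (fun x => u' x - g x)%R /\
    v = \int[mu]_(x in I) ((u' x - g x) ^+ 2)%:E
        + (eps^-1)%:E * \int[mu]_(x in I) (fc (eps * avg eps g x))%:E].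

(** test functions for the flat norm: phi in W^{1,oo}_0(a,b),
    ||phi||_{W^{1,oo}} = max(||phi||_oo, ||phi'||_oo) <= 1 *)
Definition flat_test (phi : R -> R) :=
  phi a = 0%R /\ phi b = 0%R /\
  (forall x, (a <= x <= b)%R -> (`|phi x| <= 1)%R) /\
  (forall x y, (a <= x <= b)%R -> (a <= y <= b)%R ->
     (`|phi x - phi y| <= `|x - y|)%R).

Definition flatdist (g1 g2 : sm) : \bar R :=
  ereal_sup [set cint g1 I phi - cint g2 I phi | phi in flat_test].

Definition Eupper (u : R -> R) (gamma : sm) : \bar R :=
  ereal_inf [set l | exists (ue : R -> R -> R) (ge : R -> sm),
    (fun e => \int[mu]_(x in I) (`|ue e x - u x|)%:E) @ 0%R^'+ --> 0 /\
    (fun e => flatdist (ge e) gamma) @ 0%R^'+ --> 0 /\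
    l = limf_esup (fun e => Eeps e (ue e) (ge e)) 0%R^'+].

Definition Elim (u : R -> R) (gamma : sm) : \bar R :=
  ereal_inf [set v | exists (Du : sm) (u' : R -> R) (Ds : sm) (g : R -> R),
    BVder u Du /\ lebdec Du u' Ds /\ Linf_bd u K /\ L1 g /\
    (forall A : set R, measurable A ->
       gamma A = Ds A + \int[mu]_(x in A `&` I) (g x)%:E) /\
    L2 (fun x => u' x - g x)%R /\
    v = \int[mu]_(x in I) ((u' x - g x) ^+ 2)%:E
        + c0%:E * \int[mu]_(x in I) (`|g x|)%:E
        + 2%:E * (\esum_(x in jumpset Du) (fc (`|fine (Du [set x])| / 2))%:E)
        + c0%:E * tv (cantor_part Du Ds) I].

End defs.

(* Main.v *)
(** The recovery sequence is obtained by one-sided mollification at scale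
    [d = e ^+ 2].  By the lemma of du Bois-Reymond, [u] agrees a.e. with
    [c + Du(]-oo, x])], which stays bounded by [K] when extended by its trace
    [c] to the left of [a].  Averaging this function over the window
    [`]x - d, x]] gives [ue], with derivative [Du(`]x - d, x]) / d], and
    [ge x := gamma(`]x - d, x]) / d]; then [ue' - ge] is the window average of
    [u' - g], so its L2 norm does not increase (Jensen), and both convergences
    hold at rate [d] by Fubini.  For the nonlocal term, let [B] be the finite
    set of jumps of size at least 2.  Within distance [e] (up to [d]) of [B]
    the integrand is bounded by [c0], at a cost [2 * c0] per point of [B];
    elsewhere [fc t <= c0 * t], and by Tonelli the average costs at most [c0]
    times the variation of [gamma] off [B], up to the masses of two boundary
    layers, which vanish with [e].  That variation is at most
    [\int |g| + |D^c u| + \sum_(jumps of size < 2) |[u]|]. *)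
Require Import Defs.
From HB Require Import structures.
From mathcomp Require Import all_boot all_order all_algebra.
From mathcomp Require Import all_classical all_reals all_analysis.
From mathcomp Require Import measurable_realfun lra.
Import Order.TTheory GRing.Theory Num.Theory.
Import numFieldNormedType.Exports.
Local Open Scope classical_set_scope.
Local Open Scope ring_scope.
Set Implicit Arguments. Unset Strict Implicit. Unset Printing Implicit Defensive.

(** * Tonelli and Fubini for kernels depending on [x - y] *)

Section difference_kernels.
Context {R : realType}.
Implicit Types (J : set R) (x y d : R).
Local Notation RT := (measurableTypeR R).
Local Open Scope ereal_scope.

(** About the whole construction. The windows are one-sided because a point [x < b] then never sees
    anything beyond [b], so that only the trace at [a] has to be controlled. A jump becomes a ramp
    of width [d], felt by the nonlocal term on an interval of length [2 * e + d]; after division by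
    [e] this costs [c0 * (2 + d / e)], so [d] must be of smaller order than [e]. The threshold 2 is
    where [f(t / 2)] saturates: a jump of size [t] has energy [2 * f(t / 2)], which is [c0 * t]
    below 2 and [2 * c0] above, so the linear bound and the constant bound are each sharp on their
    own class of jumps. The obstacle at the endpoints is that the average is taken over a truncated
    window, whose length may drop from [2 * e] towards [e]; mass near [a] or [b] is then counted up
    to twice. The excess is paid by the mass of [gamma] in layers of width of order [e], and it
    vanishes because [gamma] charges only the open interval. *)

Lemma measurable_diff J : measurable J -> measurable [set z : RT * RT | J (z.1 - z.2)%R].
Proof.
move=> mJ.
have mf : measurable_fun setT (fun z : RT * RT => (z.1 - z.2)%R : R).
  by apply: measurable_funB; [exact: measurable_fst|exact: measurable_snd].
by have := mf measurableT J mJ; rewrite setTI.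
Qed.

Lemma measurable_diffr J x : measurable J -> measurable [set y : R | J (x - y)%R].
Proof.
move=> mJ.
have mf : measurable_fun setT (fun y : R => (x - y)%R).
  by apply: measurable_funB; [exact: measurable_cst|exact: measurable_id].
by have := mf measurableT J mJ; rewrite setTI.
Qed.

Lemma measurable_fun_mass_diff (m : {sigma_finite_measure set RT -> \bar R}) J :
  measurable J -> measurable_fun [set: R] (fun x => m [set y | J (x - y)%R]).
Proof.
move=> mJ; have /= := measurable_fun_xsection m (measurable_diff mJ).
apply: eq_measurable_fun => x _ /=; congr (m _); apply/seteqP; split => y /=.
  by rewrite /xsection/= inE.
by rewrite /xsection/= inE.
Qed.

(** One statement serves every window of the proof through the choice of [J]: [[0, d[] gives the
    mollification, [[0, +oo[] the distribution function, []-e, e[] the nonlocal average, []-d, 0]]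
    the averages of functions. *)
Lemma tonelli_diff (m1 m2 : {sigma_finite_measure set RT -> \bar R}) J
    (F : R -> \bar R) :
  measurable J -> measurable_fun [set: R] F -> (forall x, 0 <= F x) ->
  \int[m1]_x (F x * m2 [set y | J (x - y)%R]) =
  \int[m2]_y \int[m1]_(x in [set x | J (x - y)%R]) F x.
Proof.
move=> mJ mF F0; pose S := [set z : RT * RT | J (z.1 - z.2)%R].
have mS : measurable S by exact: measurable_diff.
transitivity (\int[m1]_x \int[m2]_y (F x * (\1_S (x, y))%:E)).
  apply: eq_integral => x _.
  have mSx := measurable_diffr x mJ.
  rewrite ge0_integralZl//; last first.
    apply/measurable_EFinP => /=.
    rewrite [X in measurable_fun _ X](_ : _ = \1_([set y | J (x - y)%R])).
      exact: measurable_indic.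
    by apply/funext => y; rewrite !indicE; congr ((_ : bool)%:R); apply/idP/idP; rewrite !inE.
  have := integral_indic m2 measurableT mSx; rewrite setIT => <-; congr (_ * _).
rewrite (@fubini_tonelli _ _ _ _ _ m1 m2 (fun z => F z.1 * (\1_S z)%:E))//; last 2 first.
- apply: emeasurable_funM; first exact: measurableT_comp.
  by apply/measurable_EFinP; exact: measurable_indic.
- by move=> z; rewrite mule_ge0.
apply: eq_integral => y _; rewrite [RHS]integral_mkcond.
apply: eq_integral => x _; rewrite patchE indicE.
have -> : ((x, y) \in S) = (x \in [set x | J (x - y)%R]) by apply/idP/idP; rewrite !inE.
by case: ifP; rewrite ?mule1 ?mule0.
Qed.

(** The signed version, meant for derivatives of test functions. The integrand is absolutely
    integrable on the product since its inner integral is at most [|F x|] times the finite mass of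
    [m2]. *)
Lemma fubini_diff (m1 : {sigma_finite_measure set RT -> \bar R})
    (m2 : {finite_measure set RT -> \bar R}) J (F : R -> R) :
  measurable J -> m1.-integrable [set: R] (EFin \o F) ->
  \int[m1]_x ((F x)%:E * m2 [set y | J (x - y)%R]) =
  \int[m2]_y \int[m1]_(x in [set x | J (x - y)%R]) (F x)%:E.
Proof.
move=> mJ iF; pose S := [set z : RT * RT | J (z.1 - z.2)%R].
have mS : measurable S by exact: measurable_diff.
have mF := measurable_int _ iF.
have SE x y : (\1_S (x, y) = \1_([set y | J (x - y)%R]) y :> R)%R.
  by rewrite !indicE; congr ((_ : bool)%:R); apply/idP/idP; rewrite !inE.
have mf : measurable_fun setT (fun z : RT * RT => (F z.1)%:E * (\1_S z)%:E).
  apply: emeasurable_funM.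
    by apply: (measurableT_comp mF); exact: measurable_fst.
  by apply/measurable_EFinP; exact: measurable_indic.
transitivity (\int[m1]_x \int[m2]_y ((F x)%:E * (\1_S (x, y))%:E)).
  apply: eq_integral => x _.
  have mSx := measurable_diffr x mJ.
  under eq_integral do rewrite SE.
  rewrite integralZl//; last first.
    apply: integrable_indic => //; rewrite ?setTI//.
  by congr (_ * _); rewrite integral_indic// setIT.
rewrite (@Fubini _ _ _ _ _ m1 m2 (fun z => (F z.1)%:E * (\1_S z)%:E))//; last first.
  apply/integrable12ltyP => //=.
  apply: (@le_lt_trans _ _ (\int[m1]_x (`|(F x)%:E| * m2 setT))).
    apply: ge0_le_integral => //.
    - by move=> x _; exact: integral_ge0.
    - by apply: (@measurable_fun_fubini_tonelli_F _ _ _ _ _ m2 (fun z => `|(F z.1)%:E * (\1_S z)%:E|)) => //; apply: measurableT_comp.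
    - by apply: emeasurable_funM => //; apply: measurableT_comp.
    - move=> x _; rewrite -integral_cst//; apply: ge0_le_integral => //.
      + apply/measurable_EFinP; apply: measurableT_comp => //; under eq_fun do rewrite SE.
        by apply: measurable_funM => //; apply: measurable_indic; exact: measurable_diffr.
      + by move=> y _; rewrite /= lee_fin normrM ler_piMr// indicE; case: (_ \in _); rewrite /= ?normr1 ?normr0.
  rewrite ge0_integralZr//; last by apply: measurableT_comp.
  rewrite lte_mul_pinfty//; first exact: integral_ge0.
  - by apply: integrable_fin_num => //; exact: integrable_abse.
  - by rewrite ltey_eq fin_num_measure.
apply: eq_integral => y _; rewrite [RHS]integral_mkcond.
apply: eq_integral => x _; rewrite patchE indicE.
have -> : ((x, y) \in S) = (x \in [set x | J (x - y)%R]) by apply/idP/idP; rewrite !inE.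
by case: ifP; rewrite ?mule1 ?mule0.
Qed.

End difference_kernels.

(** * Integrals against charges and against measures with a density *)

Section finite_measures.
Context {R : realType}.
Local Notation RT := (measurableTypeR R).
Local Notation leb := (@lebesgue_measure R).
Local Open Scope ereal_scope.

Lemma integrable_bounded (m : {finite_measure set RT -> \bar R}) (D : set R)
    (phi : R -> R) (M : R) :
  measurable D -> measurable_fun D phi ->
  (forall x, D x -> (`|phi x| <= M)%R) -> m.-integrable D (EFin \o phi).
Proof.
move=> mD mphi phiM.
apply: (@le_integrable _ _ _ m D mD _ (EFin \o cst M)) => //.
- exact/measurable_EFinP.
- by move=> x Dx /=; rewrite lee_fin (le_trans (phiM _ Dx))// ler_norm.
- exact: finite_measure_integrable_cst.
Qed.

(** [cint] is built on one chosen Jordan decomposition, but any way of writing [nu] on [D] as a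
    difference of finite measures gives the same value: [p + m2] and [n + m1] coincide on subsets of
    [D], and all integrals are finite. *)
Lemma cint_decomp (nu : sm) (m1 m2 : {finite_measure set RT -> \bar R})
    (D : set R) (phi : R -> R) (M : R) :
  (forall A : set R, measurable A -> A `<=` D -> nu A = m1 A - m2 A) ->
  measurable D -> measurable_fun D phi ->
  (forall x, D x -> (`|phi x| <= M)%R) ->
  cint nu D phi = \int[m1]_(x in D) (phi x)%:E - \int[m2]_(x in D) (phi x)%:E.
Proof.
move=> nuE mD mphi phiM; rewrite /cint.
set p : {finite_measure set RT -> \bar R} := jordan_pos (hahnH nu).
set n : {finite_measure set RT -> \bar R} := jordan_neg (hahnH nu).
have iphi (m : {finite_measure set RT -> \bar R}) : m.-integrable D (EFin \o phi).
  exact: integrable_bounded mD mphi phiM.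
have fphi (m : {finite_measure set RT -> \bar R}) :
    \int[m]_(x in D) (phi x)%:E \is a fin_num.
  exact: integrable_fin_num (iphi m).
have pn A : measurable A -> A `<=` D -> measure_add p m2 A = measure_add n m1 A.
  move=> mA AD; rewrite /measure_add/= /msum !big_ord_recl !big_ord0/= !adde0.
  have := jordan_decomp (hahnH nu) mA; rewrite nuE// /cadd/= /cscale/= -/p -/n.
  rewrite -(fineK (fin_num_measure p _ mA)) -(fineK (fin_num_measure n _ mA)).
  rewrite -(fineK (fin_num_measure m1 _ mA)) -(fineK (fin_num_measure m2 _ mA)).
  rewrite -!EFinM -!EFinB -!EFinD => -[e]; congr EFin; lra.
have := @eq_measure_integral _ RT R D (measure_add n m1) (measure_add p m2) (EFin \o phi) pn.
rewrite integral_measure_add//; [|exact: iphi..].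
rewrite integral_measure_add//; [|exact: iphi..].
rewrite -(fineK (fphi p)) -(fineK (fphi n)) -(fineK (fphi m1)) -(fineK (fphi m2)).
rewrite -!EFinB -!EFinD => -[e]; congr EFin; lra.
Qed.

Section density.
Variable f : R -> R.
Hypothesis f0 : forall x, (0 <= f x)%R.
Hypothesis intf : leb.-integrable setT (EFin \o f).

Let nonneg (A : set RT) : 0 <= induced_charge intf A.
Proof. by apply: integral_ge0 => x _; rewrite /= lee_fin. Qed.

Definition density : set RT -> \bar R := measure_of_charge (induced_charge intf) nonneg.

HB.instance Definition _ := Measure.on density.

Let density_fin : fin_num_fun density.
Proof. by move=> A mA; exact: (fin_num_measure (induced_charge intf)). Qed.

HB.instance Definition _ := Measure_isFinite.Build _ _ _ density density_fin.

Lemma densityE (A : set R) : density A = \int[leb]_(x in A) (f x)%:E.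
Proof. by []. Qed.

(** The change of variables holds for the Radon-Nikodym derivative of [density], which equals [f]
    almost everywhere because both have the same integral over every measurable set. *)
Lemma integral_density (D : set R) (phi : R -> R) (M : R) :
  measurable D -> measurable_fun D phi ->
  (forall x, D x -> (`|phi x| <= M)%R) ->
  \int[density]_(x in D) (phi x)%:E = \int[leb]_(x in D) (phi x * f x)%:E.
Proof.
move=> mD mphi phiM.
have dom : density `<< leb.
  apply/null_content_dominatesP => A mA A0.
  rewrite densityE; apply: null_set_integral => //.
  by apply: measurable_funTS; exact: measurable_int intf.
have iphi : (density : {finite_measure set RT -> \bar R}).-integrable D (EFin \o phi).
  exact: integrable_bounded mD mphi phiM.
rewrite -(Radon_Nikodym_change_of_variables dom mD iphi).
have mRN : measurable_fun setT (Radon_Nikodym (charge_of_finite_measure density) leb).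
  by apply: (measurable_int leb); exact: Radon_Nikodym_integrable.
apply: ae_eq_integral => //.
- by apply: emeasurable_funM; [exact/measurable_EFinP|exact: measurable_funTS].
- apply/measurable_EFinP; apply: measurable_funM => //.
  by apply: measurable_funTS; apply/measurable_EFinP; exact: measurable_int intf.
have : ae_eq leb D (Radon_Nikodym (charge_of_finite_measure density) leb) (EFin \o f).
  apply: integral_ae_eq => //.
  - by apply: (integrableS measurableT) => //; exact: Radon_Nikodym_integrable.
  - by apply: measurable_funTS; exact: measurable_int intf.
  - by move=> A AD mA; rewrite -Radon_Nikodym_integral.
apply: filterS => x /= h Dx; rewrite (h Dx).
by rewrite EFinM.
Qed.

End density.
End finite_measures.

(** * Integration by parts for distribution functions *)

Section integration_by_parts_measure.
Context {R : realType}.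
Local Notation RT := (measurableTypeR R).
Local Notation leb := (@lebesgue_measure R).
Local Open Scope ereal_scope.

Definition mcdf (m : set R -> \bar R) (x : R) : \bar R := m `]-oo, x]%classic.

Lemma derive1_eq0_near (phi : R -> R) (x : R) :
  (\forall y \near x, phi y = 0%R) -> derive1 phi x = 0%R.
Proof.
move=> h; rewrite derive1E (near_eq_derive (g := cst 0%R))//.
by rewrite -derive1E derive1_cst.
Qed.

Lemma derive1_support (phi : R -> R) (c d : R) :
  (forall x, (x < c)%R \/ (d < x)%R -> phi x = 0%R) ->
  forall x, (x < c)%R \/ (d < x)%R -> derive1 phi x = 0%R.
Proof.
move=> h x [xc|dx]; apply: derive1_eq0_near.
  by near=> y; apply: h; left; near: y; exact: lt_nbhsl.
by near=> y; apply: h; right; near: y; exact: lt_nbhsr.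
Unshelve. all: by end_near. Qed.

Lemma derivable_continuous1 (phi : R -> R) (x : R) :
  derivable phi x 1 -> {for x, continuous phi}.
Proof. by move=> /derivable1_diffP/differentiable_continuous. Qed.

Lemma ftc2_C1 (phi : R -> R) (y z : R) : (y < z)%R ->
  (forall x, derivable phi x 1) -> continuous (derive1 phi) ->
  \int[leb]_(x in `[y, z]) (derive1 phi x)%:E = (phi z)%:E - (phi y)%:E.
Proof.
move=> yz dphi cphi'.
have cphi : continuous phi by move=> x; exact: derivable_continuous1.
apply: continuous_FTC2; first exact: yz.
- by apply: continuous_subspaceT.
- split.
  + by move=> x _; exact: dphi.
  + by apply: cvg_at_right_filter; exact: cphi.
  + by apply: cvg_at_left_filter; exact: cphi.
- by [].
Qed.

Lemma integrable_C0c (f : R -> R) (c d : R) : continuous f ->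
  (forall x, (x < c)%R \/ (d < x)%R -> f x = 0%R) ->
  leb.-integrable setT (EFin \o f).
Proof.
move=> cf f0.
have icd : leb.-integrable `[c, d] (EFin \o f).
  apply: continuous_compact_integrable; first exact: segment_compact.
  by apply: continuous_subspaceT.
move: icd; rewrite integrable_mkcond//; apply: eq_integrable => // x _.
rewrite patchE; case: ifPn => //= /negP xcd; congr EFin; apply/esym/f0.
move: xcd; rewrite inE/= in_itv/=; case: (ltP x c) => [|cx]; first by left.
by case: (ltP d x) => [|xd]; [right|move=> /(_ isT)].
Qed.

Lemma bounded_C0c (f : R -> R) (c d : R) : continuous f ->
  (forall x, (x < c)%R \/ (d < x)%R -> f x = 0%R) ->
  exists M, (0 <= M)%R /\ forall x, (`|f x| <= M)%R.
Proof.
move=> cf f0; have [cd|dc] := leP c d; last first.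
  exists 0%R; split => // x; rewrite f0 ?normr0//.
  by case: (ltP x c) => [|cx]; [left|right; exact: lt_le_trans cx].
have [|y ycd ymax] := @EVT_max R (fun x => `|f x|%R) c d cd.
  apply: continuous_subspaceT => x; apply: continuous_comp; first exact: cf.
  exact: norm_continuous.
exists `|f y|%R; split => // x.
have [xc|cx] := ltP x c; first by rewrite f0 ?normr0//; left.
have [dx|xd] := ltP d x; first by rewrite f0 ?normr0//; right.
by apply: ymax; rewrite in_itv/= cx xd.
Qed.

(** After exchanging the integrals, each [y] contributes the integral of [phi'] over [[y, +oo[],
    which is [- phi y]. *)
Lemma ibp_measure (m : {finite_measure set RT -> \bar R}) (phi : R -> R) (c d : R) :
  (forall x, derivable phi x 1) -> continuous (derive1 phi) ->
  (forall x, (x < c)%R \/ (d < x)%R -> phi x = 0%R) ->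
  \int[leb]_x ((derive1 phi x)%:E * mcdf m x) = - \int[m]_x (phi x)%:E.
Proof.
move=> dphi cphi' phi0; have phi'0 := derive1_support phi0.
have cphi : continuous phi by move=> x; exact: derivable_continuous1.
transitivity (\int[leb]_x ((derive1 phi x)%:E * m [set y | `[0%R, +oo[%classic (x - y)%R])).
  apply: eq_integral => x _; rewrite /mcdf; congr (_ * m _).
  by apply/seteqP; split => y /=; rewrite !in_itv/= andbT subr_ge0.
rewrite (fubini_diff m (measurable_itv _) (integrable_C0c cphi' phi'0)).
have [M [_ phiM]] := bounded_C0c cphi phi0.
rewrite -integralN; last first.
  apply: integrable_add_def => //; apply: (@integrable_bounded _ m setT phi M) => //.
  by apply: continuous_measurable_fun => x; exact: cphi.
apply: eq_integral => y _.
(* Any point beyond both [y] and the support will do: the half-line is cut there without changing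
   the integral, and [phi z = 0]. *)
pose z := (Num.max d y + 1)%R.
have yz : (y < z)%R by rewrite ltr_pwDr// le_max lexx orbT.
have dz : (d < z)%R by rewrite ltr_pwDr// le_max lexx.
transitivity (\int[leb]_(x in `[y, z]) (derive1 phi x)%:E).
  have -> : [set x : R | `[0%R, +oo[%classic (x - y)%R] = `[y, +oo[%classic.
    by apply/seteqP; split => x /=; rewrite !in_itv/= !andbT subr_ge0.
  rewrite integral_mkcond [RHS]integral_mkcond; apply: eq_integral => x _.
  rewrite !patchE !mem_setE !in_itv/= andbT.
  case: ifPn => [yx|]; last by case: (y <= x)%R.
  case: ifPn => // ; rewrite /= -ltNge => zx.
  by rewrite phi'0//; right; exact: lt_trans dz zx.
by rewrite ftc2_C1// phi0 ?sub0e//; right.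
Qed.

Lemma ibp_test (m : {finite_measure set RT -> \bar R}) (a b : R) (phi : R -> R) :
  test_fun a b phi ->
  \int[leb]_(x in I a b) (fine (mcdf m x) * derive1 phi x)%:E =
  - \int[m]_(x in I a b) (phi x)%:E.
Proof.
move=> [dphi [cphi' [c [d [ac [db phi0]]]]]].
have out (x : R) : ~ I a b x -> (x < c)%R \/ (d < x)%R.
  rewrite /I /= in_itv/=; case: (ltP a x) => [ax|xa] /=.
    by case: (ltP x b) => // bx _; right; exact: lt_le_trans bx.
  by move=> _; left; exact: le_lt_trans ac.
rewrite integral_mkcond [in RHS]integral_mkcond.
transitivity (\int[leb]_x ((derive1 phi x)%:E * mcdf m x)).
  apply: eq_integral => x _; rewrite patchE; case: ifPn => [_|/negP].
    by rewrite EFinM fineK ?fin_num_measure// muleC.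
  by rewrite inE => /out /(derive1_support phi0) ->; rewrite mul0e.
rewrite (ibp_measure m dphi cphi' phi0); congr (- _).
apply: eq_integral => x _; rewrite patchE; case: ifPn => // /negP.
by rewrite inE => /out/phi0 ->.
Qed.

End integration_by_parts_measure.

(** * The lemma of du Bois-Reymond *)

Section du_Bois_Reymond.
Context {R : realType}.
Local Notation leb := (@lebesgue_measure R).

(** The primitive starting at [-oo] vanishes left of the support trivially, and right of it because
    it has collected the whole integral, which is 0. *)
Lemma primitive_C0c (psi : R -> R) (c d : R) : continuous psi ->
  (forall x, x < c \/ d < x -> psi x = 0) ->
  \int[leb]_x psi x = 0 ->
  exists phi : R -> R, [/\ forall x, derivable phi x 1, derive1 phi = psi &
    forall x, x < c \/ d < x -> phi x = 0].
Proof.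
move=> cpsi psi0 int0; have ipsi := integrable_C0c cpsi psi0.
pose phi (x : R) := \int[leb]_(t in `]-oo, x]) psi t.
have dphi x : derivable phi x 1 /\ derive1 phi x = psi x.
  apply: (@continuous_FTC1 R psi -oo%O x (x + 1)).
  - by rewrite ltrDl.
  - exact: (integrableS measurableT).
  - exact: ltNyr.
  - exact: cpsi.
exists phi; split.
- by move=> x; have [] := dphi x.
- by apply/funext => x; have [] := dphi x.
- move=> x [xc|dx]; rewrite /phi.
    rewrite (_ : Rintegral _ _ _ = \int[leb]_(t in `]-oo, x]) (cst 0 t)); first by rewrite Rintegral_cst// mul0r.
    apply: eq_Rintegral.
    by move=> t; rewrite inE/= in_itv/= => tx; apply: psi0; left; exact: le_lt_trans xc.
  rewrite -int0 Rintegral_mkcond; apply: eq_Rintegral => t _.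
  rewrite patchE mem_setE in_itv/=; case: ifPn => //; rewrite -ltNge => xt.
  by rewrite psi0//; right; exact: lt_trans xt.
Qed.

(** Derivatives of test functions must be continuous, so these hats replace indicators of intervals
    as probes around [s]. *)
Definition tent (s h x : R) : R := Num.max 0 (1 - `|x - s| / h).

Lemma tent_continuous (s h : R) : continuous (tent s h).
Proof.
move=> x; rewrite /tent.
apply: (@continuous_max R R (cst 0) (fun x => 1 - `|x - s| / h) x); first exact: cvg_cst.
apply: cvgB; first exact: cvg_cst.
apply: cvgM; last exact: cvg_cst.
apply: (@continuous_comp _ _ _ (fun x => x - s) Num.norm).
  by apply: cvgB; [exact: cvg_id|exact: cvg_cst].
exact: norm_continuous.
Qed.

Lemma tent_far (s h x : R) : 0 < h -> h <= `|x - s| -> tent s h x = 0.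
Proof.
move=> h0 hx; rewrite /tent; apply/max_idPl.
by rewrite subr_le0 ler_pdivlMr// mul1r.
Qed.

Lemma tent_out (s h x : R) : 0 < h -> x < s - h \/ s + h < x -> tent s h x = 0.
Proof.
move=> h0 hx; apply: tent_far => //.
by case: hx => hx; [rewrite ltr0_norm ?opprB; lra|rewrite gtr0_norm; lra].
Qed.

Lemma tent_ge0 (s h x : R) : 0 <= tent s h x.
Proof. by rewrite /tent le_max lexx. Qed.

Lemma tent_le1 (s h x : R) : 0 < h -> tent s h x <= 1.
Proof. by move=> h0; rewrite /tent ge_max ler01/= gerBl divr_ge0// ltW. Qed.

Lemma tent_integrable (s h : R) : 0 < h -> leb.-integrable setT (EFin \o tent s h).
Proof.
move=> h0; apply: (@integrable_C0c R _ (s - h) (s + h)) => //; first exact: tent_continuous.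
by move=> x; exact: tent_out.
Qed.

(** The tent is at least [1/2] on the middle half of its support, which has length [h]. This crude
    bound is enough for comparison with averages over balls. *)
Lemma tent_Rintegral_ge (s h : R) : 0 < h -> h / 2 <= \int[leb]_x tent s h x.
Proof.
move=> h0; pose J := `[s - h / 2, s + h / 2]%classic : set R.
have muJ : leb J = h%:E.
  rewrite /J lebesgue_measure_itv/= lte_fin -EFinB ifT; first by congr EFin; lra.
  lra.
have iJ : leb.-integrable setT (EFin \o (fun x => 2^-1 * \1_J x)).
  apply: (@integrableZl _ _ _ leb setT measurableT 2^-1 (EFin \o \1_J)).
  exact: integrable_indic_itv.
have -> : h / 2 = \int[leb]_x (2^-1 * \1_J x).
  rewrite RintegralZl//; last exact: integrable_indic_itv.
  have := integral_indic leb measurableT (measurable_itv _ : measurable J).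
  by rewrite setIT => e; rewrite /Rintegral (etrans e muJ)/= mulrC.
apply: le_Rintegral => //; first exact: tent_integrable.
move=> x _; rewrite indicE; case: (boolP (x \in J)); last by rewrite mulr0 tent_ge0.
rewrite /J inE/= in_itv/= => /andP[x1 x2]; rewrite mulr1 /tent le_max; apply/orP; right.
rewrite lerBrDr -lerBrDl ler_pdivrMr// ler_norml; apply/andP; split; lra.
Qed.

Lemma integrable_mul_bounded (D : set R) (f psi : R -> R) (M : R) : measurable D ->
  leb.-integrable D (EFin \o f) -> measurable_fun D psi ->
  (forall x, D x -> `|psi x| <= M) -> leb.-integrable D (EFin \o (fun x => f x * psi x)).
Proof.
move=> mD fi mpsi psiM.
have iM : leb.-integrable D (fun x => M%:E * (EFin \o f) x)%E by exact: integrableZl.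
apply: (le_integrable _ _ _ iM) => //.
  apply/measurable_EFinP; apply: measurable_funM => //.
  by apply/measurable_EFinP; exact: measurable_int fi.
move=> x Dx /=; rewrite lee_fin !normrM mulrC ler_wpM2r//.
exact: le_trans (psiM x Dx) (ler_norm _).
Qed.

(** A combination of two tents with total integral 0 is the derivative of a test function. Hence the
    tent average of [f] is the same number [c] at every place and scale inside the interval, and at
    a Lebesgue point it converges to the value of [f]. *)
Lemma du_Bois_Reymond (a b : R) (f : R -> R) : a < b -> L1 a b f ->
  (forall phi, test_fun a b phi ->
     \int[leb]_(x in I a b) (f x * derive1 phi x)%:E = 0)%E ->
  exists c, {ae leb, forall x, I a b x -> f x = c}.
Proof.
move=> ab fL1 H; pose F := f \_ (I a b).
have mI : measurable (I a b) by exact: measurable_itv.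
have iF : leb.-integrable setT (EFin \o F).
  by move: fL1; rewrite /L1 integrable_mkcond// restrict_EFin.
have Fcst psi c d : a < c -> d < b -> continuous psi ->
    (forall x, x < c \/ d < x -> psi x = 0) -> \int[leb]_x psi x = 0 ->
    \int[leb]_x (F x * psi x) = 0.
  move=> ac db cpsi psi0 int0; have [phi [dphi phi' phi0]] := primitive_C0c cpsi psi0 int0.
  have /H : test_fun a b phi.
    by split; [exact: dphi|split; [rewrite phi'; exact: cpsi|exists c, d]].
  rewrite phi' integral_mkcond => h.
  rewrite /Rintegral (_ : \int[leb]_x _ = 0)%E// -[RHS]h; apply: eq_integral => x _.
  by rewrite /F !patchE; case: ifPn; rewrite ?mul0r.
have iFpsi psi c d : continuous psi -> (forall x, x < c \/ d < x -> psi x = 0) ->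
    leb.-integrable setT (EFin \o (fun x => F x * psi x)).
  move=> cpsi psi0; have [M [_ psiM]] := bounded_C0c cpsi psi0.
  apply: (@integrable_mul_bounded _ _ _ M) => //.
  by apply: continuous_measurable_fun.
(* The reference tent: centred at the midpoint, with support well inside the interval. It fixes the
   candidate [c]. *)
pose s0 := (a + b) / 2; pose h0 := (b - a) / 4.
have h00 : 0 < h0 by rewrite /h0; lra.
pose S0 := \int[leb]_x tent s0 h0 x.
have S00 : 0 < S0 by apply: lt_le_trans (tent_Rintegral_ge s0 h00); lra.
pose c := (\int[leb]_x (F x * tent s0 h0 x)) / S0.
have Fc s h : 0 < h -> a < s - h -> s + h < b ->
    \int[leb]_x (F x * tent s h x) = c * \int[leb]_x tent s h x.
  move=> h_gt0 ash shb; pose S := \int[leb]_x tent s h x.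
  pose c1 := Num.min (s - h) (s0 - h0); pose d1 := Num.max (s + h) (s0 + h0).
  have itent := tent_integrable s h_gt0.
  have iZ : leb.-integrable setT (EFin \o (fun x => - (S / S0) * tent s0 h0 x)).
    apply: (@integrableZl _ _ _ leb setT measurableT (- (S / S0)) (EFin \o tent s0 h0)).
    exact: tent_integrable.
  have out0 x : x < c1 \/ d1 < x -> tent s h x = 0 /\ tent s0 h0 x = 0.
    rewrite /c1 /d1 lt_min gt_max => -[/andP[x1 x2]|/andP[x1 x2]].
      by split; apply: tent_out => //; left.
    by split; apply: tent_out => //; right.
  have iF1 : leb.-integrable setT (EFin \o (fun x => F x * tent s h x)).
    by apply: (iFpsi _ (s - h) (s + h)); [exact: tent_continuous|move=> x; exact: tent_out].
  have iF2 : leb.-integrable setT (EFin \o (fun x => F x * tent s0 h0 x)).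
    by apply: (iFpsi _ (s0 - h0) (s0 + h0)); [exact: tent_continuous|move=> x; exact: tent_out].
  (* The coefficient [S / S0] makes the total integral vanish. *)
  have := Fcst (fun x => tent s h x + - (S / S0) * tent s0 h0 x) c1 d1.
  rewrite RintegralD// RintegralZl//; last exact: tent_integrable.
  under [in X in _ -> _ -> _ -> _ -> _ -> X]eq_Rintegral do rewrite mulrDr mulrCA.
  rewrite RintegralD//; last first.
    exact: (@integrableZl _ _ _ leb setT measurableT (- (S / S0)) (EFin \o (fun x => F x * tent s0 h0 x))).
  rewrite RintegralZl// => Z.
  have {Z} /eqP : \int[leb]_x (F x * tent s h x) + - (S / S0) * \int[leb]_x (F x * tent s0 h0 x) = 0.
    apply: Z.
    - by rewrite /c1 lt_min ash/= /s0 /h0; lra.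
    - by rewrite /d1 gt_max shb/= /s0 /h0; lra.
    - move=> x; apply: cvgD; first exact: tent_continuous.
      by apply: cvgM; [exact: cvg_cst|exact: tent_continuous].
    - by move=> x /out0[-> ->]; rewrite mulr0 addr0.
    - by rewrite -/S -/S0 mulNr divfK ?subrr// gt_eqF.
  rewrite mulNr subr_eq0 => /eqP ->; rewrite -/S /c.
  by rewrite [RHS]mulrAC mulrC mulrA.
exists c.
have := lebesgue_differentiation (integrable_locally mI fL1).
apply: filterS; first exact: (ae_filter_ringOfSetsType leb).
move=> s Fs Is; rewrite -/F in Fs.
have FsE : F s = f s by rewrite /F patchE mem_set.
(* The factor 4 compares normalisations: the tent has mass at least [r / 2], whereas [davg] divides
   by the length [2 * r] of the ball. *)
have key r : 0 < r -> a < s - r -> s + r < b ->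
    (`|f s - c|%:E <= 4%:E * davg F s r)%E.
  move=> r0 asr srb; pose S := \int[leb]_x tent s r x.
  have Sr : r / 2 <= S by exact: tent_Rintegral_ge.
  have itent := tent_integrable s r0.
  have mB : measurable (ball s r : set R) by exact: measurable_ball.
  have iB : leb.-integrable (ball s r) (EFin \o (fun x => F x - F s)).
    apply: (@integrableB _ _ _ leb _ mB (EFin \o F) (cst (F s)%:E)).
      exact: (integrableS measurableT).
    apply/integrableP; split => //; rewrite integral_cst//.
    apply: lte_mul_pinfty => //.
    have := lebesgue_measure_ball s (ltW r0); rewrite /ball_ /= => e.
    by apply: (@eq_ind_r _ _ (fun z => (z < +oo)%E) (ltry (r *+ 2)) _ e).
  have iF1 : leb.-integrable setT (EFin \o (fun x => F x * tent s r x)).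
    by apply: (iFpsi _ (s - r) (s + r)); [exact: tent_continuous|move=> x; exact: tent_out].
  have E1 : (c - F s) * S = \int[leb]_x (F x * tent s r x + - F s * tent s r x).
    rewrite RintegralD//; last exact: (@integrableZl _ _ _ leb setT measurableT (- F s) (EFin \o tent s r)).
    by rewrite RintegralZl// Fc// -/S mulrDl.
  have E2 : \int[leb]_x (F x * tent s r x + - F s * tent s r x) =
      \int[leb]_(x in ball s r) ((F x - F s) * tent s r x).
    rewrite [RHS]Rintegral_mkcond; apply: eq_Rintegral => x _.
    rewrite -mulrDl patchE; case: ifPn => // /negP; rewrite inE /ball/= => /negP.
    by rewrite -leNgt distrC => /(tent_far r0) ->; rewrite mulr0.
  have iBt : leb.-integrable (ball s r) (EFin \o (fun x => (F x - F s) * tent s r x)).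
    apply: (le_integrable _ _ _ iB) => //.
      apply/measurable_EFinP; apply: measurable_funM.
        by apply/measurable_EFinP; exact: measurable_int iB.
      by apply: measurable_funTS; apply: continuous_measurable_fun; exact: tent_continuous.
    move=> x _ /=; rewrite lee_fin normrM ler_piMr// ger0_norm ?tent_ge0//.
    exact: tent_le1.
  have E3 : `|f s - c| * S <= \int[leb]_(x in ball s r) `|F x - F s|.
    have S0' : 0 <= S by rewrite (le_trans _ Sr)// divr_ge0// ltW.
    rewrite -{1}(ger0_norm S0') -normrM -FsE -normrN -mulNr opprB E1 E2.
    apply: le_trans (le_normr_Rintegral _ _) _ => //.
    apply: le_Rintegral => //.
    - exact: integrable_norm iBt.
    - exact: integrable_norm iB.
    - move=> x _; rewrite normrM ler_piMr// ger0_norm ?tent_ge0//; exact: tent_le1.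
  rewrite /davg /iavg (lebesgue_measure_ball _ (ltW r0)).
  have -> : (\int[leb]_(y in ball s r) `|((center (F s) \o F) y)%:E| =
      (\int[leb]_(x in ball s r) `|F x - F s|)%:E)%E.
    rewrite /Rintegral fineK//; apply: integrable_fin_num => //.
    exact: integrable_norm iB.
  rewrite inver mulrn_eq0/= (gt_eqF r0) -!EFinM lee_fin.
  apply: (@le_trans _ _ (2 / r * \int[leb]_(x in ball s r) `|F x - F s|)).
    rewrite mulrC mulrA ler_pdivlMr// mulrC.
    have := ler_wpM2l (normr_ge0 (f s - c)) Sr; nra.
  rewrite mulrA ler_wpM2r ?Rintegral_ge0//; have -> : r *+ 2 = 2 * r by rewrite mulr_natl.
  by rewrite invfM; lra.
have : (`|f s - c|%:E <= 4%:E * 0)%E.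
  apply: (@cvge_to_ge _ (0^'+ : set_system R) _ R (fun r => 4%:E * davg F s r)%E).
    by apply: cvgeZl.
  move: Is; rewrite /I/= in_itv/= => /andP[as_ sb].
  near=> r; apply: key.
  - by near: r; exact: nbhs_right_gt.
  - rewrite ltrBrDr -ltrBrDl; near: r; apply: nbhs_right_lt; lra.
  - rewrite -ltrBrDl; near: r; apply: nbhs_right_lt; lra.
rewrite mule0 lee_fin normr_le0 subr_eq0 => /eqP //.
Unshelve. all: by end_near. Qed.

End du_Bois_Reymond.

(** * One-sided mollification of finite measures *)

Section mollification.
Context {R : realType}.
Local Notation RT := (measurableTypeR R).
Local Notation leb := (@lebesgue_measure R).
Implicit Types (m : {finite_measure set RT -> \bar R}) (d x y : R).
Local Open Scope ereal_scope.

(* No measurability is needed: the integral of a nonnegative function is a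
   supremum over the simple functions below it. *)
Lemma ge0_le_integral_nomeas (m : {measure set RT -> \bar R}) (f1 f2 : R -> \bar R) :
  (forall x, 0 <= f1 x) -> (forall x, f1 x <= f2 x) ->
  \int[m]_x f1 x <= \int[m]_x f2 x.
Proof.
move=> f10 f12; rewrite !ge0_integralTE//; last by move=> x; exact: le_trans (f12 x).
apply: le_ereal_sup => _ [h hf <-]; exists h => // x.
exact: le_trans (hf x) (f12 x).
Qed.

Definition winm (m : set R -> \bar R) (d x : R) : \bar R := m `](x - d)%R, x]%classic.

(** The convolution of [m] with the probability density [d^-1] on [[0, d[]. *)
Definition mol (m : set R -> \bar R) (d x : R) : R := (fine (winm m d x) / d)%R.

Lemma win_diffr d x :
  `](x - d)%R, x]%classic = [set y | `[0%R, d[%classic (x - y)%R].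
Proof.
apply/seteqP; split => y /=; rewrite !in_itv/= => /andP[h1 h2]; apply/andP; split; lra.
Qed.

Lemma win_diffl d y :
  [set x | `[0%R, d[%classic (x - y)%R] = `[y, (y + d)%R[%classic.
Proof.
apply/seteqP; split => x /=; rewrite !in_itv/= => /andP[h1 h2]; apply/andP; split; lra.
Qed.

Lemma mcdf_diffr x :
  `]-oo, x]%classic = [set y : R | `[0%R, +oo[%classic (x - y)%R].
Proof. by apply/seteqP; split => y /=; rewrite !in_itv/= andbT subr_ge0. Qed.

Lemma mcdf_diffl y :
  [set x : R | `[0%R, +oo[%classic (x - y)%R] = `[y, +oo[%classic.
Proof. by apply/seteqP; split => x /=; rewrite !in_itv/= !andbT subr_ge0. Qed.

Lemma measurable_fun_winm m d : measurable_fun setT (winm m d).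
Proof.
have /= := @measurable_fun_mass_diff R m `[0%R, d[%classic (measurable_itv _).
by apply: eq_measurable_fun => x _; rewrite /winm win_diffr.
Qed.

Lemma measurable_fun_mcdf m : measurable_fun setT (mcdf m).
Proof.
have /= := @measurable_fun_mass_diff R m `[0%R, +oo[%classic (measurable_itv _).
by apply: eq_measurable_fun => x _; rewrite /mcdf mcdf_diffr.
Qed.

Lemma winm_fin m d x : winm m d x \is a fin_num.
Proof. exact: fin_num_measure. Qed.

Lemma mcdf_fin m x : mcdf m x \is a fin_num.
Proof. exact: fin_num_measure. Qed.

Lemma measurable_fun_mol m d : measurable_fun setT (mol m d).
Proof.
apply: measurable_funM => //.
apply: (measurableT_comp (@fine_measurable R setT measurableT)).
exact: measurable_fun_winm.
Qed.

Lemma mol_ge0 m d x : (0 < d)%R -> (0 <= mol m d x)%R.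
Proof. by move=> d0; rewrite divr_ge0 ?fine_ge0// ltW. Qed.

Lemma tonelli_winm m d (F : R -> \bar R) :
  measurable_fun setT F -> (forall x, 0 <= F x) ->
  \int[leb]_x (F x * winm m d x) =
  \int[m]_y \int[leb]_(x in `[y, (y + d)%R[%classic) F x.
Proof.
move=> mF F0.
transitivity (\int[leb]_x (F x * m [set y | `[0%R, d[%classic (x - y)%R])).
  by apply: eq_integral => x _; rewrite /winm win_diffr.
rewrite (@tonelli_diff R leb m _ F (measurable_itv _) mF F0).
by apply: eq_integral => y _; rewrite win_diffl.
Qed.

Lemma mol_winm m d x : (mol m d x)%:E = d^-1%:E * winm m d x.
Proof. by rewrite /mol EFinM fineK ?winm_fin// muleC. Qed.

Lemma tonelli_mol m d (F : R -> \bar R) : (0 < d)%R ->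
  measurable_fun setT F -> (forall x, 0 <= F x) ->
  \int[leb]_x (F x * (mol m d x)%:E) =
  d^-1%:E * \int[m]_y \int[leb]_(x in `[y, (y + d)%R[%classic) F x.
Proof.
move=> d0 mF F0; rewrite -tonelli_winm// -ge0_integralZl//.
- by apply: eq_integral => x _; rewrite mol_winm muleCA.
- by apply: emeasurable_funM => //; exact: measurable_fun_winm.
- by move=> x _; rewrite mule_ge0// /winm.
- by rewrite lee_fin invr_ge0 ltW.
Qed.

Lemma leb_co (y z : R) : (y <= z)%R -> leb `[y, z[%classic = (z - y)%:E.
Proof.
move=> yz; rewrite lebesgue_measure_itv/= lte_fin -EFinB.
by case: ltP => // zy; congr EFin; apply/eqP; rewrite eq_sym subr_eq0 eq_le yz zy.
Qed.

Lemma leb_oc (y z : R) : (y <= z)%R -> leb `]y, z]%classic = (z - y)%:E.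
Proof.
move=> yz; rewrite lebesgue_measure_itv/= lte_fin -EFinB.
by case: ltP => // zy; congr EFin; apply/eqP; rewrite eq_sym subr_eq0 eq_le yz zy.
Qed.

Lemma integral_mol m d : (0 < d)%R -> \int[leb]_x (mol m d x)%:E = m setT.
Proof.
move=> d0; have := @tonelli_mol m d (cst 1) d0 (measurable_cst _) (fun=> lee01).
under eq_integral do rewrite mul1e.
move=> ->; rewrite (_ : integral m _ _ = \int[m]_y d%:E).
  by rewrite integral_cst// muleA -EFinM mulVf ?mul1e// gt_eqF.
apply: eq_integral => y _; rewrite integral_cst// mul1e.
have yd : (y <= y + d)%R by rewrite lerDl ltW.
by apply: etrans (leb_co yd) _; rewrite addrAC subrr add0r.
Qed.

Lemma integrable_mol m d : (0 < d)%R -> leb.-integrable setT (EFin \o mol m d).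
Proof.
move=> d0; apply/integrableP; split.
  by apply/measurable_EFinP; exact: measurable_fun_mol.
under eq_integral do rewrite /= ger0_norm ?mol_ge0//.
by rewrite integral_mol// ltey_eq fin_num_measure.
Qed.

Lemma integral_winm m d : (0 < d)%R -> \int[leb]_x winm m d x = d%:E * m setT.
Proof.
move=> d0; rewrite -(integral_mol m d0) -ge0_integralZl//.
- by apply: eq_integral => x _; rewrite mol_winm muleA -EFinM divff ?gt_eqF// mul1e.
- by apply/measurable_EFinP; exact: measurable_fun_mol.
- by move=> x _; rewrite lee_fin mol_ge0.
- by rewrite lee_fin ltW.
Qed.

Definition smooth m d (d0 : (0 < d)%R) : {finite_measure set RT -> \bar R} :=
  density (fun x => mol_ge0 m x d0) (integrable_mol m d0).

Lemma smoothE m d (d0 : (0 < d)%R) (A : set R) :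
  smooth m d0 A = \int[leb]_(x in A) (mol m d x)%:E.
Proof. by []. Qed.

(** Both lengths are the positive part of [min(d, x - y)]: the convolution of the indicators of [[0,
    d[] and [[0, +oo[] can be read in either order. *)
Lemma leb_overlap d x y : (0 < d)%R ->
  leb (`[y, (y + d)%R[ `&` `]-oo, x]) = leb (`[y, +oo[ `&` `](x - d)%R, x]).
Proof.
move=> d0; have [xdy|yxd] := ltP (x - d)%R y.
  congr (leb _); apply/seteqP; split => z /=; rewrite !in_itv/= ?andbT.
    by move=> [/andP[? ?] ?]; split; [|apply/andP; split]; lra.
  by move=> [? /andP[? ?]]; split; [apply/andP; split|]; lra.
transitivity (leb `[y, (y + d)%R[%classic).
  congr (leb _); apply/seteqP; split => z /=; rewrite !in_itv/=; first by case.
  by move=> /andP[? ?]; split; [apply/andP; split|]; lra.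
transitivity (leb `](x - d)%R, x]%classic).
  have yd : (y <= y + d)%R by rewrite lerDl ltW.
  have xd : (x - d <= x)%R by rewrite gerBl ltW.
  by rewrite leb_co// leb_oc//; congr EFin; lra.
congr (leb _); apply/seteqP; split => z /=; rewrite !in_itv/= ?andbT; last by case.
by move=> /andP[? ?]; split; [|apply/andP; split]; lra.
Qed.

(** Smoothing the measure is averaging its distribution function. By Tonelli both sides are
    [m]-integrals in [y], of the two lengths compared in [leb_overlap]. *)
Lemma mcdf_smooth m d (d0 : (0 < d)%R) x :
  mcdf (smooth m d0) x = d^-1%:E * \int[leb]_(t in `](x - d)%R, x]%classic) mcdf m t.
Proof.
have i1 (A B : set R) : measurable A -> measurable B ->
    \int[leb]_(t in B) (\1_A t)%:E = leb (B `&` A).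
  by move=> mA mB; rewrite setIC; exact: integral_indic.
have -> : mcdf (smooth m d0) x = \int[leb]_t ((\1_(`]-oo, x]%classic) t)%:E * (mol m d t)%:E).
  rewrite /mcdf smoothE integral_mkcond; apply: eq_integral => t _.
  by rewrite patchE indicE; case: (t \in _); rewrite ?mul1e ?mul0e.
rewrite tonelli_mol//; last first.
  by apply/measurable_EFinP; exact: measurable_indic.
congr (_ * _).
have -> : \int[leb]_(t in `](x - d)%R, x]%classic) mcdf m t =
    \int[leb]_t ((\1_(`](x - d)%R, x]%classic) t)%:E * m [set y | `[0%R, +oo[%classic (t - y)%R]).
  rewrite integral_mkcond; apply: eq_integral => t _.
  by rewrite patchE indicE /mcdf -mcdf_diffr; case: (t \in _); rewrite ?mul1e ?mul0e.
have mi : measurable_fun setT (fun t => (\1_(`](x - d)%R, x]%classic) t)%:E : \bar R).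
  by apply/measurable_EFinP; exact: measurable_indic.
rewrite (@tonelli_diff R leb m _ _ (measurable_itv _) mi); last by move=> t; rewrite lee_fin.
apply: eq_integral => y _; rewrite mcdf_diffl !i1; [|by []..].
exact: leb_overlap.
Qed.

Lemma le_mcdf m x y : (x <= y)%R -> mcdf m x <= mcdf m y.
Proof.
move=> xy; apply: le_measure; rewrite ?inE//.
by move=> z /=; rewrite !in_itv/= => /le_trans; apply.
Qed.

Lemma mcdf_winm m d x : (0 < d)%R -> mcdf m x = mcdf m (x - d) + winm m d x.
Proof.
move=> d0; rewrite /mcdf /winm -measureU//.
  congr (m _); apply/seteqP; split => z /=; rewrite !in_itv/=.
    by move=> zx; case: (leP z (x - d)%R) => h; [left|right; rewrite zx].
  by case=> [h|/andP[]//]; lra.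
by apply/seteqP; split => z //=; rewrite !in_itv/= => -[h /andP[h' _]]; lra.
Qed.

(** A window average of the nondecreasing [mcdf m] lies between the values at the two ends of the
    window, and these differ by [winm m d x]. *)
Lemma mcdf_smooth_bounds m d (d0 : (0 < d)%R) x :
  (fine (mcdf m x) - fine (winm m d x) <= fine (mcdf (smooth m d0) x) <= fine (mcdf m x))%R.
Proof.
have xd : (x - d <= x)%R by rewrite gerBl ltW.
have Idc (k : \bar R) : d^-1%:E * \int[leb]_(t in `](x - d)%R, x]%classic) cst k t = k.
  have e : leb `](x - d)%R, x]%classic = d%:E by rewrite leb_oc//; congr EFin; lra.
  rewrite integral_cst//.
  transitivity (d^-1%:E * (k * d%:E)); first by congr (_ * (_ * _)).
  by rewrite muleCA -EFinM mulVf ?gt_eqF// mule1.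
have mm : measurable_fun `](x - d)%R, x] (mcdf m).
  by apply: measurable_funTS; exact: measurable_fun_mcdf.
have d10 : (0 <= d^-1%:E :> \bar R) by rewrite lee_fin invr_ge0 ltW.
have -> : (fine (mcdf m x) - fine (winm m d x) = fine (mcdf m (x - d)))%R.
  by rewrite (mcdf_winm m x d0) fineD ?mcdf_fin ?winm_fin// addrK.
rewrite -!lee_fin !fineK ?mcdf_fin//; apply/andP; split; rewrite mcdf_smooth.
  rewrite -[leLHS]Idc lee_wpmul2l//; apply: ge0_le_integral => //.
  by move=> t /=; rewrite in_itv/= => /andP[/ltW h _]; exact: le_mcdf.
rewrite -[leRHS]Idc lee_wpmul2l//; apply: ge0_le_integral => //.
by move=> t /=; rewrite in_itv/= => /andP[_ h]; exact: le_mcdf.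
Qed.

End mollification.

(** * Jordan parts and masses of shrinking boundary layers *)

Section jordan.
Context {R : realType}.
Local Notation RT := (measurableTypeR R).
Local Notation leb := (@lebesgue_measure R).
Implicit Types (m : {finite_measure set RT -> \bar R}) (nu : @sm R).
Local Open Scope ereal_scope.

Definition jp nu : {finite_measure set RT -> \bar R} := jordan_pos (hahnH nu).
Definition jn nu : {finite_measure set RT -> \bar R} := jordan_neg (hahnH nu).

Lemma jordan_sub nu (A : set R) : measurable A -> nu A = jp nu A - jn nu A.
Proof.
move=> mA; rewrite (jordan_decomp (hahnH nu) mA) /cadd/= /cscale/=.
by rewrite mulN1e.
Qed.

Lemma jpE nu (A : set R) : measurable A -> jp nu A = nu (A `&` hahnP nu).
Proof.
move=> mA; rewrite -[LHS]/(jordan_pos (hahnH nu) A) jordan_posE/= /crestr0/=.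
by rewrite mem_set.
Qed.

Lemma jnE nu (A : set R) : measurable A -> jn nu A = - nu (A `&` hahnN nu).
Proof.
move=> mA; rewrite -[LHS]/(jordan_neg (hahnH nu) A) jordan_negE/= /cscale/= mulN1e /crestr0/=.
by rewrite mem_set.
Qed.

Lemma measurable_hahnP nu : measurable (hahnP nu).
Proof. by have [[]] := hahnH nu. Qed.

Lemma measurable_hahnN nu : measurable (hahnN nu).
Proof. by have [_ []] := hahnH nu. Qed.

Lemma jp_concentrated (a b : R) nu (A : set R) : concentrated a b nu ->
  measurable A -> A `&` I a b = set0 -> jp nu A = 0.
Proof.
move=> cnu mA A0; have mP := measurable_hahnP nu.
rewrite jpE// cnu; last exact: measurableI.
by rewrite setIAC A0 set0I charge0.
Qed.

Lemma jn_concentrated (a b : R) nu (A : set R) : concentrated a b nu ->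
  measurable A -> A `&` I a b = set0 -> jn nu A = 0.
Proof.
move=> cnu mA A0; have mN := measurable_hahnN nu.
rewrite jnE// cnu; last exact: measurableI.
by rewrite setIAC A0 set0I charge0 oppe0.
Qed.

Lemma itvNyc_I (a b x : R) : (x <= a)%R -> `]-oo, x]%classic `&` I a b = set0.
Proof.
move=> xa; apply/seteqP; split => y //=; rewrite /I/= !in_itv/= => -[h /andP[h' _]]; lra.
Qed.

Lemma itvcy_I (a b x : R) : (b <= x)%R -> `[x, +oo[%classic `&` I a b = set0.
Proof.
move=> xa; apply/seteqP; split => y //=; rewrite /I/= !in_itv/= andbT => -[h /andP[_ h']]; lra.
Qed.

Lemma ae_ex (P : R -> Prop) (A : set R) :
  {ae leb, forall x, P x} -> measurable A -> 0 < leb A -> exists x, A x /\ P x.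
Proof.
move=> [N [mN N0 PN]] mA A0; apply: contrapT => h.
have AN : A `<=` N by move=> x Ax; apply: PN => /= Px; apply: h; exists x.
have : leb A <= leb N by apply: le_measure; rewrite ?inE.
by rewrite N0 leNgt A0.
Qed.

Lemma nonincreasing_mass_small m (F : nat -> set R) : (forall n, measurable (F n)) ->
  (forall n k, (n <= k)%N -> F k `<=` F n) -> m (\bigcap_n F n) = 0 ->
  forall e : R, (0 < e)%R -> exists n, m (F n) < e%:E.
Proof.
move=> mF hF F0 e e0.
have : m \o F @ \oo --> m (\bigcap_n F n).
  apply: nonincreasing_cvg_mu => //.
  - by rewrite ltey_eq fin_num_measure ?orbT//; exact: mF.
  - exact: bigcapT_measurable.
  - by move=> n k nk; apply/subsetPset; exact: hF.
rewrite F0 => /fine_cvgP[_ /cvgrPdist_lt /(_ _ e0)] [n _ /(_ n)].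
rewrite /= leqnn sub0r normrN => /(_ isT) h; exists n.
rewrite -(fineK (fin_num_measure m _ (mF n))) lte_fin.
exact: le_lt_trans (ler_norm _) h.
Qed.

(** Right-continuity of the distribution function at [a]. It serves twice: for the trace of [u] at
    [a], and for the left boundary layer of the nonlocal term. *)
Lemma mcdf_right_small m (a : R) : mcdf m a = 0 ->
  forall e : R, (0 < e)%R -> exists2 r, (0 < r)%R & mcdf m (a + r)%R < e%:E.
Proof.
move=> ma e e0.
have [|||n hn] := @nonincreasing_mass_small m (fun n => `]-oo, (a + n.+1%:R^-1)%R]%classic) _ _ _ e e0.
- by [].
- move=> n k nk x /=; rewrite !in_itv/= => /le_trans; apply; rewrite lerD2l lef_pV2 ?posrE//.
  by rewrite ler_nat.
- rewrite (_ : \bigcap_n _ = `]-oo, a]%classic)//.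
  apply/seteqP; split => x /=; last first.
    by rewrite in_itv/= => xa n _ /=; rewrite in_itv/= (le_trans xa)// lerDl.
  move=> h; rewrite in_itv/= leNgt; apply/negP => ax.
  have xa0 : (0 < x - a)%R by rewrite subr_gt0.
  have [k kx] : exists k : nat, (k.+1%:R^-1 < x - a)%R.
    by exists (Num.truncn (x - a)^-1); rewrite invf_plt ?posrE// truncnS_gt.
  by have := h k Logic.I; rewrite /= in_itv/= leNgt -ltrBrDl kx.
- by exists n.+1%:R^-1%R.
Qed.

Lemma mass_left_small m (b : R) : m `[b, +oo[%classic = 0 ->
  forall e : R, (0 < e)%R -> exists2 r, (0 < r)%R & m `[(b - r)%R, +oo[%classic < e%:E.
Proof.
move=> mb e e0.
have [|||n hn] := @nonincreasing_mass_small m (fun n => `[(b - n.+1%:R^-1)%R, +oo[%classic) _ _ _ e e0.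
- by [].
- move=> n k nk x /=; rewrite !in_itv/= !andbT; apply: le_trans; rewrite lerD2l lerN2 lef_pV2 ?posrE//.
  by rewrite ler_nat.
- rewrite (_ : \bigcap_n _ = `[b, +oo[%classic)//.
  apply/seteqP; split => x /=; last first.
    by rewrite in_itv/= andbT => xa n _ /=; rewrite in_itv/= andbT (le_trans _ xa)// gerBl.
  move=> h; rewrite in_itv/= andbT leNgt; apply/negP => ax.
  have xa0 : (0 < b - x)%R by rewrite subr_gt0.
  have [k kx] : exists k : nat, (k.+1%:R^-1 < b - x)%R.
    by exists (Num.truncn (b - x)^-1); rewrite invf_plt ?posrE// truncnS_gt.
  by have := h k Logic.I; rewrite /= in_itv/= andbT leNgt ltrBrDr -ltrBrDl kx.
- by exists n.+1%:R^-1%R.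
Qed.

End jordan.

(** * Representation and smoothing of BV functions *)

Section smoothing_BV.
Context {R : realType}.
Local Notation RT := (measurableTypeR R).
Local Notation leb := (@lebesgue_measure R).
Implicit Types (m p n : {finite_measure set RT -> \bar R}) (a b d K x : R).
Local Open Scope ereal_scope.

Lemma measurable_I a b : measurable (I a b).
Proof. exact: measurable_itv. Qed.

Lemma leb_I_lty a b : leb (I a b) < +oo.
Proof. by rewrite /I lebesgue_measure_itv/=; case: ifP => _; rewrite ltry. Qed.

Lemma L1_bounded a b (f : R -> R) (M : R) : measurable_fun (I a b) f ->
  (forall x, I a b x -> (`|f x| <= M)%R) -> L1 a b f.
Proof.
move=> mf fM; apply: measurable_bounded_integrable => //.
- exact: measurable_I.
- exact: leb_I_lty.
- exists M; split; first exact: num_real.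
  by move=> y My x Ix /=; exact: le_trans (fM _ Ix) (ltW My).
Qed.

Lemma fine_mcdf_le m x : (fine (mcdf m x) <= fine (m setT))%R.
Proof.
rewrite -lee_fin !fineK ?mcdf_fin ?fin_num_measure//.
by apply: le_measure; rewrite ?inE.
Qed.

Lemma fine_mcdf_ge0 m x : (0 <= fine (mcdf m x))%R.
Proof. by rewrite fine_ge0// /mcdf. Qed.

Lemma measurable_fine_mcdf m (D : set R) :
  measurable_fun D (fun x => fine (mcdf m x)).
Proof.
apply: measurable_funTS; apply: (measurableT_comp (@fine_measurable R setT measurableT)).
exact: measurable_fun_mcdf.
Qed.

(* The BV function with derivative [p - n] and limit [c] at [-oo]. *)
Definition bvfun p n (c x : R) : R := (c + (fine (mcdf p x) - fine (mcdf n x)))%R.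

Lemma measurable_bvfun p n c (D : set R) : measurable_fun D (bvfun p n c).
Proof.
by apply: measurable_funD => //; apply: measurable_funB; exact: measurable_fine_mcdf.
Qed.

Lemma bvfun_bounded p n c x :
  (`|bvfun p n c x| <= `|c| + (fine (p setT) + fine (n setT)))%R.
Proof.
rewrite /bvfun (le_trans (ler_normD _ _))// lerD2l (le_trans (ler_normB _ _))//.
by rewrite !ger0_norm ?fine_mcdf_ge0// lerD// fine_mcdf_le.
Qed.

Lemma test_fun_bounds a b (phi : R -> R) : test_fun a b phi ->
  exists M, [/\ forall x, (`|phi x| <= M)%R, forall x, (`|derive1 phi x| <= M)%R,
    measurable_fun setT phi & measurable_fun setT (derive1 phi)].
Proof.
move=> [dphi [cphi' [c [e [ac [eb phi0]]]]]].
have cphi : continuous phi by move=> x; exact: derivable_continuous1.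
have [M1 [M10 h1]] := bounded_C0c cphi phi0.
have [M2 [M20 h2]] := bounded_C0c cphi' (derive1_support phi0).
exists (M1 + M2)%R; split.
- by move=> x; rewrite (le_trans (h1 x))// lerDl.
- by move=> x; rewrite (le_trans (h2 x))// lerDr.
- exact: continuous_measurable_fun.
- exact: continuous_measurable_fun.
Qed.

(** The constant drops out because [phi] vanishes at [a] and [b]; the two distribution functions are
    handled by [ibp_test]. *)
Lemma bvfun_weak_derivative a b p n c (phi : R -> R) : (a < b)%R -> test_fun a b phi ->
  \int[leb]_(x in I a b) (bvfun p n c x * derive1 phi x)%:E =
  - (\int[p]_(x in I a b) (phi x)%:E - \int[n]_(x in I a b) (phi x)%:E).
Proof.
move=> ab tphi; have [M [phiM phi'M mphi mphi']] := test_fun_bounds tphi.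
have mI := measurable_I a b.
have iphi m : m.-integrable (I a b) (EFin \o phi).
  by apply: integrable_bounded => //; exact: measurable_funTS.
have iphi' (f : R -> R) : L1 a b f ->
    leb.-integrable (I a b) (EFin \o (fun x => f x * derive1 phi x)%R).
  by move=> fL1; apply: (@integrable_mul_bounded _ _ _ _ M) => //; exact: measurable_funTS.
have ip m : L1 a b (fun x => fine (mcdf m x)).
  apply: (@L1_bounded _ _ _ (fine (m setT))); first exact: measurable_fine_mcdf.
  by move=> x _; rewrite ger0_norm ?fine_mcdf_ge0// fine_mcdf_le.
have ic : L1 a b (fun=> c) by apply: (@L1_bounded _ _ _ `|c|%R).
have int0 : \int[leb]_(x in I a b) (c * derive1 phi x)%:E = 0.
  case: tphi => dphi [cphi' [c' [e [ac [eb phi0]]]]].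
  have phi'0 := derive1_support phi0.
  rewrite [LHS](_ : _ = \int[leb]_(x in I a b) (c%:E * (derive1 phi x)%:E)); last first.
    by apply: eq_integral => x _; rewrite EFinM.
  rewrite integralZl//; last first.
    by apply: (@L1_bounded _ _ _ M) => //; exact: measurable_funTS.
  rewrite [X in _ * X](_ : _ = \int[leb]_(x in `[a, b]) (derive1 phi x)%:E); last first.
    rewrite integral_mkcond [RHS]integral_mkcond; apply: eq_integral => x _.
    rewrite !patchE /I !mem_setE !in_itv/=.
    case: ifPn => [/andP[/ltW -> /ltW ->]//|nab]; case: ifPn => // /andP[ax xb].
    rewrite phi'0//; move: nab; rewrite negb_and -!leNgt => /orP[xa|bx].
      by left; exact: le_lt_trans ac.
    by right; exact: lt_le_trans bx.
  by rewrite ftc2_C1// !phi0 ?sube0 ?mule0//; [left|right].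
have split1 : \int[leb]_(x in I a b) (bvfun p n c x * derive1 phi x)%:E =
    \int[leb]_(x in I a b) (c * derive1 phi x)%:E +
    (\int[leb]_(x in I a b) (fine (mcdf p x) * derive1 phi x)%:E
     - \int[leb]_(x in I a b) (fine (mcdf n x) * derive1 phi x)%:E).
  rewrite -integralB_EFin; [|exact: mI|exact/iphi'/ip..].
  rewrite -integralD_EFin; [|exact: mI|exact/iphi'|]; last first.
    apply: (@integrableB _ _ _ leb _ mI
      (EFin \o (fun x => fine (mcdf p x) * derive1 phi x)%R)
      (EFin \o (fun x => fine (mcdf n x) * derive1 phi x)%R)); exact/iphi'/ip.
  by apply: eq_integral => x _; rewrite /bvfun mulrDl mulrBl.
rewrite split1 int0 add0e !ibp_test// oppeK fin_num_oppeB//.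
exact: integrable_fin_num (iphi n).
Qed.

Lemma BV_repr a b (u : R -> R) (Du : sm) : (a < b)%R -> BVder a b u Du ->
  exists c, {ae leb, forall x, I a b x -> u x = bvfun (jp Du) (jn Du) c x}.
Proof.
move=> ab [uL1 [_ hu]]; pose f x := (u x - bvfun (jp Du) (jn Du) 0 x)%R.
have mI := measurable_I a b.
have bL1 : L1 a b (bvfun (jp Du) (jn Du) 0).
  apply: L1_bounded; first exact: measurable_bvfun.
  by move=> x _; exact: bvfun_bounded.
have fL1 : L1 a b f.
  exact: (@integrableB _ _ _ leb _ mI (EFin \o u) (EFin \o bvfun (jp Du) (jn Du) 0)).
have [phi tphi|c hc] := @du_Bois_Reymond R a b f ab fL1.
  have [M [phiM phi'M mphi mphi']] := test_fun_bounds tphi.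
  have iphi' (h : R -> R) : L1 a b h ->
      leb.-integrable (I a b) (EFin \o (fun x => h x * derive1 phi x)%R).
    by move=> hL1; apply: (@integrable_mul_bounded _ _ _ _ M) => //; exact: measurable_funTS.
  transitivity (\int[leb]_(x in I a b) (u x * derive1 phi x)%:E -
      \int[leb]_(x in I a b) (bvfun (jp Du) (jn Du) 0 x * derive1 phi x)%:E).
    rewrite -integralB_EFin; [|exact: mI|exact/iphi'..].
    by apply: eq_integral => x _; rewrite /f mulrBl.
  rewrite hu// bvfun_weak_derivative// -[cint Du (I a b) phi]/(_ - _) subee//.
  have iphi m : m.-integrable (I a b) (EFin \o phi).
    by apply: integrable_bounded => //; exact: measurable_funTS.
  rewrite fin_numN fin_numB; apply/andP; split.
    exact: integrable_fin_num (iphi (jp Du)).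
  exact: integrable_fin_num (iphi (jn Du)).
exists c; move: hc; apply: filterS; first exact: (ae_filter_ringOfSetsType leb).
move=> x h Ix; have := h Ix; by rewrite /f /bvfun add0r => <-; rewrite subrK.
Qed.

(** Just right of [a] both measures have accumulated almost no mass, so the function is close to [c]
    there and [c] inherits its bound. *)
Lemma bvfun_trace_bd a b p n c K : (a < b)%R ->
  {ae leb, forall x, I a b x -> (`|bvfun p n c x| <= K)%R} ->
  mcdf p a = 0 -> mcdf n a = 0 -> (`|c| <= K)%R.
Proof.
move=> ab h p0 n0; rewrite leNgt; apply/negP => Kc.
(* Half the supposed gap: both distribution functions are kept in [[0, gap / 2[], so their
   difference is too small to bring [|c|] down to [K]. *)
have e0 : (0 < (`|c| - K) / 2)%R by rewrite divr_gt0// subr_gt0.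
have [r1 r10 h1] := mcdf_right_small p0 e0.
have [r2 r20 h2] := mcdf_right_small n0 e0.
pose r := Num.min (b - a)%R (Num.min r1 r2).
have r0 : (0 < r)%R by rewrite !lt_min r10 r20 subr_gt0 ab.
(* The bound holds only almost everywhere, so a good point is drawn from an interval of positive
   length. *)
have [x [xJ]] : exists x, `]a, (a + r)%R[%classic x /\ (I a b x -> (`|bvfun p n c x| <= K)%R).
  apply: ae_ex => //; rewrite lebesgue_measure_itv/= lte_fin ltrDl r0 -EFinB lte_fin.
  by rewrite addrAC subrr add0r.
move: xJ; rewrite /= in_itv/= => /andP[ax xar].
have rr1 : (r <= r1)%R by rewrite !ge_min lexx !orbT.
have rr2 : (r <= r2)%R by rewrite !ge_min lexx !orbT.
have rb : (r <= b - a)%R by rewrite ge_min lexx.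
have small m r' : (x <= a + r')%R -> mcdf m (a + r')%R < ((`|c| - K) / 2)%:E ->
    (0 <= fine (mcdf m x) < (`|c| - K) / 2)%R.
  move=> xr hm; rewrite fine_mcdf_ge0 -lte_fin fineK ?mcdf_fin//.
  exact: le_lt_trans (le_mcdf m xr) hm.
have /andP[P0 P1] := small p r1 ltac:(lra) h1.
have /andP[N0 N1] := small n r2 ltac:(lra) h2.
have : I a b x by rewrite /I/= in_itv/= ax/=; lra.
move=> /[swap] /[apply]; rewrite /bvfun => bK.
have : (`|c| <= K + `|fine (mcdf p x) - fine (mcdf n x)|)%R.
  have := ler_normB (c + (fine (mcdf p x) - fine (mcdf n x)))%R (fine (mcdf p x) - fine (mcdf n x))%R.
  by rewrite addrK => /le_trans; apply; rewrite lerD2r.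
have : (`|fine (mcdf p x) - fine (mcdf n x)| < (`|c| - K) / 2)%R.
  by rewrite ltr_norml; apply/andP; split; lra.
lra.
Qed.

(** Windows of points near [a] reach beyond [a], where the function is the constant [c]. *)
Lemma bvfun_left_bd a b p n c K : (a < b)%R ->
  {ae leb, forall x, I a b x -> (`|bvfun p n c x| <= K)%R} ->
  mcdf p a = 0 -> mcdf n a = 0 ->
  {ae leb, forall x, (x < b)%R -> (`|bvfun p n c x| <= K)%R}.
Proof.
move=> ab h p0 n0; have cK := bvfun_trace_bd ab h p0 n0.
move: h; apply: filterS; first exact: (ae_filter_ringOfSetsType leb).
move=> x h xb; have [xa|ax] := leP x a; last by apply: h; rewrite /I/= in_itv/= ax.
have zero m : mcdf m a = 0 -> mcdf m x = 0.
  by move=> m0; apply/eqP; rewrite eq_le -{1}m0 le_mcdf//= /mcdf.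
by rewrite /bvfun !zero// subrr addr0.
Qed.

(** Two views of the recovery function: on the left it has a derivative with a density, on the right
    it is an average, so bounds and L1 closeness pass to it from the original function. *)
Lemma bvfun_smooth p n c d (d0 : (0 < d)%R) x :
  bvfun (smooth p d0) (smooth n d0) c x =
  (d^-1 * \int[leb]_(t in `](x - d)%R, x]%classic) bvfun p n c t)%R.
Proof.
have xd : (x - d <= x)%R by rewrite gerBl ltW.
have e : leb `](x - d)%R, x]%classic = d%:E by rewrite leb_oc//; congr EFin; lra.
have mW : measurable (`](x - d)%R, x]%classic : set RT) by exact: measurable_itv.
have ib (f : R -> R) M : measurable_fun `](x - d)%R, x]%classic f ->
    (forall t, (`|f t| <= M)%R) -> leb.-integrable `](x - d)%R, x]%classic (EFin \o f).
  move=> mf fM; apply: measurable_bounded_integrable => //.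
    by apply: (@eq_ind_r _ _ (fun z => (z < +oo)%E) (ltry d) _ e).
  exists M; split; first exact: num_real.
  by move=> y My t _ /=; exact: le_trans (fM t) (ltW My).
have im m : leb.-integrable `](x - d)%R, x]%classic (EFin \o (fun t => fine (mcdf m t))).
  apply: (@ib _ (fine (m setT))); first exact: measurable_fine_mcdf.
  by move=> t; rewrite ger0_norm ?fine_mcdf_ge0// fine_mcdf_le.
have sm m : fine (mcdf (smooth m d0) x) =
    (d^-1 * \int[leb]_(t in `](x - d)%R, x]%classic) fine (mcdf m t))%R.
  rewrite mcdf_smooth fineM//; last first.
    have := integrable_fin_num mW (im m); congr (_ \is a fin_num).
    by apply: eq_integral => t _ /=; rewrite fineK ?mcdf_fin.
  congr (_ * fine _)%R; apply: eq_integral => t _ /=; by rewrite fineK ?mcdf_fin.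
rewrite /bvfun RintegralD//; last 2 first.
- by apply: (@ib _ `|c|%R).
- by apply: (@integrableB _ _ _ leb _ mW (EFin \o (fun t => fine (mcdf p t))) (EFin \o (fun t => fine (mcdf n t)))).
rewrite RintegralB// !sm mulrDr mulrBr; congr (_ + _)%R.
rewrite Rintegral_cst//; have -> : fine (leb `](x - d)%R, x]%classic) = d by rewrite e.
by rewrite mulrCA mulVf ?mulr1// gt_eqF.
Qed.

Lemma bvfun_smooth_bd b p n c K d (d0 : (0 < d)%R) x : (0 <= K)%R ->
  {ae leb, forall x, (x < b)%R -> (`|bvfun p n c x| <= K)%R} -> (x < b)%R ->
  (`|bvfun (smooth p d0) (smooth n d0) c x| <= K)%R.
Proof.
move=> K0 h xb; rewrite bvfun_smooth normrM ger0_norm; last by rewrite invr_ge0 ltW.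
rewrite mulrC ler_pdivrMr//.
have xd : (x - d <= x)%R by rewrite gerBl ltW.
have e : leb `](x - d)%R, x]%classic = d%:E by rewrite leb_oc//; congr EFin; lra.
have mW : measurable (`](x - d)%R, x]%classic : set RT) by exact: measurable_itv.
have ib : leb.-integrable `](x - d)%R, x]%classic (EFin \o bvfun p n c).
  apply: measurable_bounded_integrable => //.
  - by apply: (@eq_ind_r _ _ (fun z => (z < +oo)%E) (ltry d) _ e).
  - exact: measurable_bvfun.
  exists (`|c| + (fine (p setT) + fine (n setT)))%R; split; first exact: num_real.
  by move=> y My t _ /=; exact: le_trans (bvfun_bounded _ _ _ _) (ltW My).
apply: le_trans (le_normr_Rintegral mW ib) _.
rewrite -lee_fin /Rintegral fineK; last first.
  exact: integrable_fin_num (integrable_norm ib).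
have -> : (K * d)%:E = \int[leb]_(t in `](x - d)%R, x]%classic) cst K%:E t.
  rewrite integral_cst// EFinM; congr (_ * _); exact/esym.
apply: ae_ge0_le_integral => //.
- by apply/measurable_EFinP; apply: measurableT_comp => //; exact: measurable_bvfun.
- move: h; apply: filterS; first exact: (ae_filter_ringOfSetsType leb).
  move=> t h; rewrite /= in_itv/= => /andP[_ tx]; rewrite lee_fin h//.
  exact: le_lt_trans xb.
Qed.

Lemma W11_bvfun_smooth a b p n c d (d0 : (0 < d)%R) : (a < b)%R ->
  W11 a b (bvfun (smooth p d0) (smooth n d0) c) (fun x => mol p d x - mol n d x)%R.
Proof.
move=> ab; have mI := measurable_I a b.
have im m : leb.-integrable (I a b) (EFin \o mol m d).
  by apply: (integrableS measurableT) => //; exact: integrable_mol.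
split; first by apply: L1_bounded; [exact: measurable_bvfun|move=> x _; exact: bvfun_bounded].
split.
  exact: (@integrableB _ _ _ leb _ mI (EFin \o mol p d) (EFin \o mol n d)).
move=> phi tphi; have [M [phiM phi'M mphi mphi']] := test_fun_bounds tphi.
rewrite bvfun_weak_derivative//; congr (- _).
have mphiI : measurable_fun (I a b) phi by exact: measurable_funTS.
have idens m := @integral_density R _ (fun x => mol_ge0 m x d0) (integrable_mol m d0)
  (I a b) phi M mI mphiI (fun x _ => phiM x).
have iphi m : leb.-integrable (I a b) (EFin \o (fun x => mol m d x * phi x)%R).
  exact: (@integrable_mul_bounded _ _ _ _ M).
transitivity (\int[leb]_(x in I a b) (mol p d x * phi x)%:E -
   \int[leb]_(x in I a b) (mol n d x * phi x)%:E).
  congr (_ - _); (etransitivity; first exact: idens);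
    by apply: eq_integral => x _; rewrite mulrC.
rewrite -integralB_EFin; [|exact: mI|exact: iphi..].
by apply: eq_integral => x _; rewrite mulrBl.
Qed.

Lemma winm_ge0 m d x : 0 <= winm m d x.
Proof. by rewrite /winm. Qed.

(** Pointwise the error is at most the [p]-mass plus the [n]-mass of the window, and each window
    mass integrates to [d] times the total mass. *)
Lemma bvfun_smooth_dist a b p n c d (d0 : (0 < d)%R) :
  \int[leb]_(x in I a b) (`|bvfun (smooth p d0) (smooth n d0) c x - bvfun p n c x|%R)%:E
  <= d%:E * (p setT + n setT).
Proof.
have mI := measurable_I a b.
apply: (@le_trans _ _ (\int[leb]_x (winm p d x + winm n d x))); last first.
  rewrite (ge0_integralD leb measurableT (fun x _ => winm_ge0 p d x)
    (measurable_fun_winm p d) (fun x _ => winm_ge0 n d x) (measurable_fun_winm n d)).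
  by rewrite !integral_winm// ge0_muleDr.
apply: (@le_trans _ _ (\int[leb]_(x in I a b) (winm p d x + winm n d x))); last first.
  apply: ge0_subset_integral => //.
    by apply: emeasurable_funD; exact: measurable_fun_winm.
  by move=> x _; rewrite adde_ge0// winm_ge0.
apply: ge0_le_integral => //.
- apply/measurable_EFinP; apply: measurableT_comp => //.
  by apply: measurable_funB; exact: measurable_bvfun.
- by apply: measurable_funTS; apply: emeasurable_funD; exact: measurable_fun_winm.
- move=> x _; rewrite -(fineK (winm_fin p d x)) -(fineK (winm_fin n d x)) -EFinD lee_fin.
  have /andP[p1 p2] := mcdf_smooth_bounds p d0 x.
  have /andP[n1 n2] := mcdf_smooth_bounds n d0 x.
  have p3 : (0 <= fine (winm p d x))%R by rewrite fine_ge0// /winm.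
  have n3 : (0 <= fine (winm n d x))%R by rewrite fine_ge0// /winm.
  by rewrite /bvfun ler_norml; apply/andP; split; lra.
Qed.

End smoothing_BV.

(** * Flat distance and L2 contraction under smoothing *)

Section flat_and_L2.
Context {R : realType}.
Local Notation RT := (measurableTypeR R).
Local Notation leb := (@lebesgue_measure R).
Implicit Types (m p n : {finite_measure set RT -> \bar R}) (a b d K x : R).
Local Open Scope ereal_scope.

Lemma smoothT m d (d0 : (0 < d)%R) : smooth m d0 setT = m setT.
Proof. by rewrite smoothE integral_mol. Qed.

(** Smoothing moves mass to the right by less than [d], which changes a 1-Lipschitz function by at
    most [d]. An upper bound suffices, since the negative part of a charge is treated with
    [- phi]. *)
Lemma flat_upper m d (d0 : (0 < d)%R) (phi : R -> R) :
  (forall x, (`|phi x| <= 1)%R) -> (forall x y, (`|phi x - phi y| <= `|x - y|)%R) ->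
  measurable_fun setT phi ->
  \int[smooth m d0]_x (phi x)%:E <= \int[m]_x (phi x)%:E + d%:E * m setT.
Proof.
move=> phi1 philip mphi.
have iphi (m' : {finite_measure set RT -> \bar R}) : m'.-integrable setT (EFin \o phi).
  by apply: integrable_bounded => //.
have fphi (m' : {finite_measure set RT -> \bar R}) : \int[m']_x (phi x)%:E \is a fin_num.
  exact: integrable_fin_num (iphi m').
have addc (m' : {finite_measure set RT -> \bar R}) (k : R) :
    \int[m']_x (phi x + k)%:E = \int[m']_x (phi x)%:E + k%:E * m' setT.
  have ic : m'.-integrable setT (EFin \o cst k) by exact: finite_measure_integrable_cst.
  have := integralD_EFin measurableT (iphi m') ic => ->.
  by congr (_ + _); rewrite -integral_cst.
have phi10 x : (0 <= phi x + 1)%R by have := phi1 x; rewrite ler_norml => /andP[]; lra.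
have mphi1 (k : R) : measurable_fun setT (fun x => phi x + k)%R by exact: measurable_funD.
(* Adding 1 makes the integrand nonnegative, so that Tonelli applies. *)
have key : \int[smooth m d0]_x (phi x + 1)%:E <= \int[m]_x (phi x + (1 + d))%:E.
  have := @integral_density R _ (fun x => mol_ge0 m x d0) (integrable_mol m d0)
    setT (fun x => phi x + 1)%R 2 measurableT (mphi1 1%R).
  move=> ->; last first.
    by move=> x _; have := phi1 x; rewrite !ler_norml => /andP[h1 h2]; apply/andP; split; lra.
  rewrite [leLHS](_ : _ = \int[leb]_x ((phi x + 1)%:E * (mol m d x)%:E)); last first.
    by apply: eq_integral => x _; rewrite EFinM.
  have meF : measurable_fun setT (fun x => (phi x + 1)%:E : \bar R).
    by apply/measurable_EFinP; exact: mphi1.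
  rewrite (tonelli_mol m d0 meF); last by move=> x; rewrite lee_fin.
  rewrite lee_pdivrMl// -ge0_integralZl//; last 3 first.
  - by apply/measurable_EFinP; exact: mphi1.
  - by move=> x _; rewrite lee_fin; have := phi10 x; lra.
  - by rewrite lee_fin ltW.
  apply: ge0_le_integral_nomeas.
  - by move=> y; apply: integral_ge0 => x _; rewrite lee_fin.
  - move=> y.
    have yd : (y <= y + d)%R by rewrite lerDl ltW.
    apply: (@le_trans _ _ (\int[leb]_(x in `[y, (y + d)%R[%classic) cst (phi y + (1 + d))%:E x)).
      apply: ge0_le_integral => //.
      + by move=> x _; rewrite lee_fin.
      + exact: measurable_funTS.
      + move=> x /=; rewrite in_itv/= lee_fin => /andP[yx xyd].
        have := philip x y; rewrite (ger0_norm (_ : 0 <= x - y)%R) ?subr_ge0//.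
        by rewrite ler_norml => /andP[_ h]; lra.
    have e : leb `[y, (y + d)%R[%classic = d%:E.
      by rewrite leb_co// addrAC subrr add0r.
    rewrite integral_cst// muleC; apply: lee_wpmul2r.
      by rewrite lee_fin; have := phi10 y; lra.
    by rewrite le_eqVlt; apply/orP; left; apply/eqP; exact: e.
move: key; rewrite !addc smoothT.
rewrite -(fineK (fphi m)) -(fineK (fphi (smooth m d0))) -(fineK (fin_num_measure m _ measurableT)).
by rewrite -!EFinM -!EFinD !lee_fin; lra.
Qed.

(** Flat test functions are controlled only on [[a, b]]. Composition with this 1-Lipschitz
    projection extends them to the line, and by 0 outside since they vanish at both ends. *)
Definition clamp a b x : R := Num.max a (Num.min x b).

Lemma clamp_itv a b x : (a <= b)%R -> (a <= clamp a b x <= b)%R.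
Proof. by move=> ab; rewrite /clamp le_max lexx/= ge_max ab ge_min lexx orbT. Qed.

Lemma clamp_id a b x : (a <= x <= b)%R -> clamp a b x = x.
Proof. by move=> /andP[ax xb]; rewrite /clamp (min_idPl xb); apply/max_idPr. Qed.

Lemma clamp_lip a b x y : (`|clamp a b x - clamp a b y| <= `|x - y|)%R.
Proof.
wlog xy : x y / (x <= y)%R => [h|].
  by have [/h//|/ltW/h] := leP x y; rewrite distrC [leRHS]distrC.
rewrite [leRHS]distrC (ger0_norm (_ : 0 <= y - x)%R) ?subr_ge0//.
rewrite /clamp ler_norml; apply/andP; split;
  (case: (leP x b) => xb; case: (leP y b) => yb);
  (case: (leP a x) => ax; case: (leP a y) => ay; case: (leP a b) => ab); lra.
Qed.

Lemma clamp_out a b x : (a <= b)%R -> ~ I a b x -> clamp a b x = a \/ clamp a b x = b.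
Proof.
move=> ab; rewrite /I/= in_itv/= /clamp; case: (ltP a x) => [ax|xa] /= h.
  right; case: (ltP x b) h => // bx _; exact/max_idPr.
left; apply/max_idPl; apply: le_trans xa; by rewrite ge_min lexx.
Qed.

Lemma flat_test_extend a b (phi : R -> R) : (a <= b)%R -> flat_test a b phi ->
  let psi := phi \o clamp a b in
  [/\ forall x, (`|psi x| <= 1)%R, forall x y, (`|psi x - psi y| <= `|x - y|)%R,
    measurable_fun setT psi &
    forall m, \int[m]_(x in I a b) (phi x)%:E = \int[m]_x (psi x)%:E].
Proof.
move=> ab [pa [pb [p1 plip]]] psi.
have psilip x y : (`|psi x - psi y| <= `|x - y|)%R.
  by rewrite (le_trans (plip _ _ _ _))// ?clamp_itv// clamp_lip.
split => //.
- by move=> x; rewrite p1// clamp_itv.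
- apply: continuous_measurable_fun => x; apply/cvgrPdist_le => e e0.
  by exists e => //= y xy; rewrite (le_trans (psilip _ _))// ltW.
- move=> m; rewrite integral_mkcond; apply: eq_integral => x _.
  rewrite patchE /psi/=; case: ifPn => [|/negP]; rewrite inE.
    by rewrite /I/= in_itv/= => /andP[/ltW ax /ltW xb]; rewrite clamp_id// ax.
  by move=> /(clamp_out ab)[] ->; rewrite ?pa ?pb.
Qed.

Lemma flatdist_le a b (gamma Gam : sm) d (d0 : (0 < d)%R) : (a < b)%R ->
  (forall A : set R, measurable A -> A `<=` I a b ->
    Gam A = smooth (jp gamma) d0 A - smooth (jn gamma) d0 A) ->
  flatdist a b Gam gamma <= d%:E * (jp gamma setT + jn gamma setT).
Proof.
move=> ab GamE; apply: ge_ereal_sup => _ [phi tphi <-].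
have [psi1 psilip mpsi psiE] := flat_test_extend (ltW ab) tphi.
set psi := phi \o clamp a b in psi1 psilip mpsi psiE.
have mI : measurable (I a b) := measurable_I a b.
have mphi : measurable_fun (I a b) phi.
  apply: (@eq_measurable_fun _ _ _ _ (I a b) psi); last exact: measurable_funTS.
  by move=> x; rewrite inE /I/= in_itv/= /psi/= => /andP[/ltW ax /ltW xb]; rewrite clamp_id// ax.
have phi1 x : I a b x -> (`|phi x| <= 1)%R.
  case: tphi => _ [_ [h _]]; rewrite /I/= in_itv/= => /andP[/ltW ax /ltW xb].
  by apply: h; rewrite ax.
rewrite (cint_decomp GamE mI mphi phi1) -[cint gamma (I a b) phi]/(_ - _).
rewrite -/(jp gamma) -/(jn gamma).
have fpsi m : \int[m]_x (psi x)%:E \is a fin_num.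
  have ipsi : m.-integrable setT (EFin \o psi) by exact: integrable_bounded.
  exact: integrable_fin_num ipsi.
have up := @flat_upper (jp gamma) d d0 psi psi1 psilip mpsi.
have un : \int[smooth (jn gamma) d0]_x (- psi x)%:E <=
    \int[jn gamma]_x (- psi x)%:E + d%:E * jn gamma setT.
  apply: (@flat_upper (jn gamma) d d0 (\- psi)%R).
  - by move=> x; rewrite normrN.
  - by move=> x y; rewrite /= opprK addrC distrC.
  - exact: measurable_funN.
have intN m : \int[m]_x (- psi x)%:E = - \int[m]_x (psi x)%:E.
  rewrite -integralN; first by apply: eq_integral.
  apply: integrable_add_def => //.
  have ipsi : m.-integrable setT (EFin \o psi) by exact: integrable_bounded.
  exact: ipsi.
move: up un; rewrite !intN; rewrite !psiE.
rewrite -(fineK (fpsi (jp gamma))) -(fineK (fpsi (jn gamma))).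
rewrite -(fineK (fpsi (smooth (jp gamma) d0))) -(fineK (fpsi (smooth (jn gamma) d0))).
rewrite -(fineK (fin_num_measure (jp gamma) _ measurableT)).
rewrite -(fineK (fin_num_measure (jn gamma) _ measurableT)).
by rewrite -!(EFinN, EFinD, EFinM) !lee_fin; lra.
Qed.

Lemma flatdist_ge0 a b (gamma Gam : sm) : 0 <= flatdist a b Gam gamma.
Proof.
apply: ereal_sup_ubound; exists (fun=> 0%R).
  by split=> //; split=> //; split => [x _|x y _ _]; rewrite ?subrr normr0.
by rewrite /cint !integral0 !sube0.
Qed.

(** Jensen's inequality for the square, from the tangent line at the window mean [q]: integrate
    [2 * q * v - q ^ 2 <= v ^ 2] over the window. *)
Lemma jensen_window (v : R -> R) d x : (0 < d)%R -> leb.-integrable setT (EFin \o v) ->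
  ((d^-1 * \int[leb]_(t in `](x - d)%R, x]%classic) v t) ^+ 2)%:E <=
  d^-1%:E * \int[leb]_(t in `](x - d)%R, x]%classic) ((v t) ^+ 2)%:E.
Proof.
move=> d0 iv; set W := `](x - d)%R, x]%classic : set RT.
have xd : (x - d <= x)%R by rewrite gerBl ltW.
have e : leb W = d%:E by rewrite /W leb_oc//; congr EFin; lra.
have mW : measurable W by exact: measurable_itv.
have ivW : leb.-integrable W (EFin \o v) by exact: (integrableS measurableT).
set q := (d^-1 * \int[leb]_(t in W) v t)%R.
have mv2 : measurable_fun W (fun t => ((v t) ^+ 2)%:E : \bar R).
  apply/measurable_EFinP; apply: measurable_funX; apply/measurable_EFinP.
  exact: measurable_int ivW.
(* If the square is not integrable on the window, the right-hand side is [+oo]; otherwise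
   real-valued integrals can be compared. *)
have [oo|fin] := eqVneq (\int[leb]_(t in W) ((v t) ^+ 2)%:E) +oo.
  by rewrite oo gt0_muley ?leey// lte_fin invr_gt0.
have iv2 : leb.-integrable W (EFin \o (fun t => (v t) ^+ 2)%R).
  apply/integrableP; split => //.
  rewrite (_ : integral leb _ _ = \int[leb]_(t in W) ((v t) ^+ 2)%:E); first by rewrite ltey.
  by apply: eq_integral => t _ /=; rewrite ger0_norm ?sqr_ge0.
have ic (k : R) : leb.-integrable W (EFin \o cst k).
  apply: measurable_bounded_integrable => //; first exact: (@eq_ind_r _ _ (fun z => (z < +oo)%E) (ltry d) _ e).
  exists `|k|%R; split; first exact: num_real.
  by move=> y ky t _ /=; exact: ltW.
have i2 : leb.-integrable W (EFin \o (fun t => 2 * q * v t)%R).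
  exact: (@integrableZl _ _ _ leb W mW (2 * q)%R (EFin \o v)).
have : (\int[leb]_(t in W) (2 * q * v t + - q ^+ 2) <= \int[leb]_(t in W) (v t) ^+ 2)%R.
  apply: le_Rintegral => //.
    exact: (@integrableD _ _ _ leb W mW (EFin \o (fun t => 2 * q * v t)%R) (EFin \o cst (- q ^+ 2)%R)).
  by move=> t _; have := sqr_ge0 (v t - q); rewrite !expr2; nra.
rewrite (RintegralD mW i2 (ic (- q ^+ 2)%R)) (RintegralZl (2 * q) mW ivW) Rintegral_cst//.
have -> : fine (leb W) = d by rewrite e.
have -> : (\int[leb]_(t in W) v t = d * q)%R by rewrite /q mulrA divff ?mul1r// gt_eqF.
move=> h.
have fv2 : \int[leb]_(t in W) ((v t) ^+ 2)%:E = (\int[leb]_(t in W) (v t) ^+ 2)%:E.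
  by rewrite /Rintegral fineK//; exact: integrable_fin_num iv2.
rewrite fv2 -EFinM lee_fin mulrC ler_pdivlMr//.
by apply: le_trans h; rewrite expr2; lra.
Qed.

Lemma integral_window (F : R -> \bar R) d : (0 < d)%R ->
  measurable_fun setT F -> (forall x, 0 <= F x) ->
  \int[leb]_x \int[leb]_(t in `](x - d)%R, x]%classic) F t = d%:E * \int[leb]_t F t.
Proof.
move=> d0 mF F0; rewrite -ge0_integralZl//; last by rewrite lee_fin ltW.
(* The inner variable lies to the left of the outer one, hence the reflected kernel. *)
have := @tonelli_diff R leb leb `](- d)%R, 0%R]%classic F (measurable_itv _) mF F0.
move=> E; etransitivity; [|etransitivity; [exact: (esym E)|]].
- apply: eq_integral => x _; congr (integral leb _ _).
  by apply/seteqP; split => t /=; rewrite !in_itv/= => /andP[? ?]; apply/andP; split; lra.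
- apply: eq_integral => x _; rewrite muleC; congr (_ * _).
  have xd : (x <= x + d)%R by rewrite lerDl ltW.
  have <- : leb `[x, (x + d)%R[%classic = d%:E by rewrite leb_co// addrAC subrr add0r.
  congr (leb _).
  by apply/seteqP; split => t /=; rewrite !in_itv/= => /andP[? ?]; apply/andP; split; lra.
Qed.

Lemma integral_window_sqr a b (v f : R -> R) d : (0 < d)%R ->
  leb.-integrable setT (EFin \o v) -> measurable_fun (I a b) f ->
  (forall x, f x = d^-1 * \int[leb]_(t in `](x - d)%R, x]%classic) v t)%R ->
  \int[leb]_(x in I a b) ((f x) ^+ 2)%:E <= \int[leb]_x ((v x) ^+ 2)%:E.
Proof.
move=> d0 iv mf fE.
have mv2 : measurable_fun setT (fun t => ((v t) ^+ 2)%:E : \bar R).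
  apply/measurable_EFinP; apply: measurable_funX; apply/measurable_EFinP.
  exact: measurable_int iv.
have v20 t : 0 <= ((v t) ^+ 2)%:E :> \bar R by rewrite lee_fin sqr_ge0.
have := integral_window d0 mv2 v20 => W.
rewrite -(@lee_pmul2l _ d%:E)// ?lte_fin// -W -ge0_integralZl//; last 4 first.
- exact: measurable_I.
- by apply/measurable_EFinP; exact: measurable_funX.
- by move=> x _; rewrite lee_fin sqr_ge0.
- by rewrite lee_fin ltW.
rewrite integral_mkcond; apply: ge0_le_integral_nomeas.
- by move=> x; rewrite patchE; case: ifPn => // _; rewrite -EFinM lee_fin mulr_ge0 ?sqr_ge0// ltW.
- move=> x; rewrite patchE; case: ifPn => [_|_]; last by rewrite integral_ge0.
  by rewrite -lee_pdivlMl// fE; exact: jensen_window.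
Qed.

End flat_and_L2.

(** * The nonlocal energy of a mollified charge *)

Section nonlocal_energy.
Context {R : realType}.
Local Notation RT := (measurableTypeR R).
Local Notation leb := (@lebesgue_measure R).
Implicit Types (m p n lam : {finite_measure set RT -> \bar R}) (a b d e x : R).
Local Open Scope ereal_scope.

Lemma Ieps_diff e x : Ieps e x = [set t | `](- e)%R, e[%classic (x - t)%R].
Proof.
apply/seteqP; split => t /=; rewrite /Ieps/= !in_itv/= => /andP[? ?]; apply/andP; split; lra.
Qed.

Lemma measurable_Ieps e x : measurable (Ieps e x).
Proof. exact: measurable_itv. Qed.

(* Dominates the inverse length of [Ieps e x `&` I a b]: the window is truncated
   by at most one half, and only when [x] is within [e] of an endpoint. *)
Definition weight a b e x : R :=
  ((2 * e)^-1 * (1 + (\1_(`]-oo, (a + e)%R]) x + \1_(`[(b - e)%R, +oo[) x)))%R.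

Lemma weight_ge0 a b e x : (0 < e)%R -> (0 <= weight a b e x)%R.
Proof.
by move=> e0; rewrite /weight mulr_ge0 ?invr_ge0 ?mulr_ge0 ?(ltW e0)//.
Qed.

Lemma measurable_weight a b e : measurable_fun setT (weight a b e).
Proof.
apply: measurable_funM => //; apply: measurable_funD => //.
by apply: measurable_funD; exact: measurable_indic.
Qed.

(** At least half of the window survives truncation: when only one side is cut, the other half of
    length [e] remains; when both are, the intersection is all of [I a b], longer than [2 * e]. *)
Lemma leb_IepsI a b e x : (0 < e)%R -> (2 * e < b - a)%R -> I a b x ->
  exists L : R, [/\ leb (Ieps e x `&` I a b) = L%:E, (0 < L)%R & (L^-1 <= weight a b e x)%R].
Proof.
move=> e0 eab; rewrite /I/= in_itv/= => /andP[ax xb].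
pose l := Num.max (x - e)%R a; pose r := Num.min (x + e)%R b.
have E : Ieps e x `&` `]a, b[%classic = `]l, r[%classic.
  apply/seteqP; split => t /=; rewrite /Ieps/= !in_itv/= /l /r gt_max lt_min.
    by move=> [/andP[-> ->] /andP[-> ->]].
  by move=> /andP[/andP[-> ->] /andP[-> ->]].
have el : (l < r)%R.
  by rewrite /l /r gt_max !lt_min; apply/andP; split; apply/andP; split; lra.
exists (r - l)%R; split; last 1 first.
- rewrite /weight; have [xa|xa] := leP x (a + e)%R.
  + have rl : (e <= r - l)%R.
      by rewrite /r /l; case: (leP (x + e)%R b) => h1; case: (leP (x - e)%R a) => h2; lra.
    rewrite (@le_trans _ _ e^-1%R)//; first by rewrite lef_pV2 ?posrE// subr_gt0.
    rewrite invfM [in leRHS]indicE mem_set/=; last by rewrite in_itv/=.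
    rewrite indicE; set z := (_ \in _); have : (0 <= z%:R :> R)%R by rewrite ler0n.
    have : (0 < e^-1)%R by rewrite invr_gt0.
    by nra.
  + have [bx|bx] := leP (b - e)%R x.
    * have rl : (e <= r - l)%R.
        by rewrite /r /l; case: (leP (x + e)%R b) => h1; case: (leP (x - e)%R a) => h2; lra.
      rewrite (@le_trans _ _ e^-1%R)//; first by rewrite lef_pV2 ?posrE// subr_gt0.
      rewrite invfM; have -> : \1_(`[(b - e)%R, +oo[) x = 1%R :> R.
        by rewrite indicE mem_set//= in_itv/= andbT.
      rewrite indicE; set z := (_ \in _); have : (0 <= z%:R :> R)%R by rewrite ler0n.
      have : (0 < e^-1)%R by rewrite invr_gt0.
      by nra.
    * have -> : (r - l = 2 * e)%R.
        by rewrite /r /l; case: (leP (x + e)%R b) => h1; case: (leP (x - e)%R a) => h2; lra.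
      rewrite ler_peMr ?invr_ge0 ?mulr_ge0 ?(ltW e0)// lerDl.
      by rewrite addr_ge0 ?indicE ?ler0n.
- rewrite E lebesgue_measure_itv/= lte_fin el -EFinB//.
- by rewrite subr_gt0.
Qed.

(** If [x] is within [e] of [t] and also within [e] of an endpoint, then [t] is within [2 * e] of
    that endpoint. This is the origin of the layer width. *)
Lemma weight_window a b e t : (0 < e)%R ->
  \int[leb]_(x in [set x | `](- e)%R, e[%classic (x - t)%R]) (weight a b e x)%:E <=
  (1 + (\1_(`]-oo, (a + 2 * e)%R]) t + \1_(`](b - 2 * e)%R, +oo[) t))%:E.
Proof.
move=> e0; set z := (1 + _)%R.
have -> : [set x | `](- e)%R, e[%classic (x - t)%R] = `](t - e)%R, (t + e)%R[%classic.
  by apply/seteqP; split => x /=; rewrite !in_itv/= => /andP[? ?]; apply/andP; split; lra.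
apply: (@le_trans _ _ (\int[leb]_(x in `](t - e)%R, (t + e)%R[%classic) cst ((2 * e)^-1 * z)%:E x)).
  apply: ge0_le_integral => //.
  - by move=> x _; rewrite lee_fin weight_ge0.
  - by apply/measurable_EFinP; apply: measurable_funTS; exact: measurable_weight.
  - move=> x /=; rewrite in_itv/= => /andP[tx xt]; rewrite lee_fin /weight ler_wpM2l//.
      by rewrite invr_ge0 mulr_ge0// ltW.
    rewrite /z lerD2l !indicE; apply: lerD; rewrite ler_nat !mem_setE !in_itv/= ?andbT.
      by case: (leP x (a + e)%R) => // h; rewrite (_ : (t <= a + 2 * e)%R)//; lra.
    by case: (leP (b - e)%R x) => // h; rewrite (_ : (b - 2 * e < t)%R)//; lra.
have E2 : leb `](t - e)%R, (t + e)%R[%classic = (2 * e)%:E.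
  rewrite lebesgue_measure_itv/= lte_fin ifT; last lra.
  by rewrite -EFinB; congr EFin; lra.
have -> : \int[leb]_(x in `](t - e)%R, (t + e)%R[%classic) cst ((2 * e)^-1 * z)%:E x =
    ((2 * e)^-1 * z)%:E * (2 * e)%:E.
  by rewrite integral_cst//; congr (_ * _).
rewrite -EFinM lee_fin.
by rewrite mulrAC mulVf ?mul1r// mulf_neq0 ?gt_eqF.
Qed.

(** Mass found beyond [x] after smoothing has moved right by less than [d]. The proof goes through
    the complementary half-lines, total mass being preserved. *)
Lemma smooth_tail m d (d0 : (0 < d)%R) x :
  smooth m d0 `]x, +oo[%classic <= m `[(x - d)%R, +oo[%classic.
Proof.
have split_m (m' : {finite_measure set RT -> \bar R}) y :
    m' setT = mcdf m' y + m' `]y, +oo[%classic.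
  rewrite /mcdf -measureU//; last first.
    by apply/seteqP; split => t //=; rewrite !in_itv/= andbT => -[h1 h2]; lra.
  congr (m' _); apply/seteqP; split => t //= _.
  by rewrite !in_itv/= andbT; case: (leP t y) => h; [left|right].
have h1 := split_m (smooth m d0) x; have h2 := split_m m (x - d)%R.
apply: (@le_trans _ _ (m `](x - d)%R, +oo[%classic)); last first.
  apply: le_measure; rewrite ?inE//.
  by move=> t /=; rewrite !in_itv/= !andbT => /ltW.
have /andP[h3 _] := mcdf_smooth_bounds m d0 x.
have h4 := mcdf_winm m x d0.
move: h1 h2 h3 h4; rewrite smoothT.
rewrite -(fineK (mcdf_fin m x)) -(fineK (mcdf_fin m (x - d)%R)) -(fineK (winm_fin m d x)).
rewrite -(fineK (mcdf_fin (smooth m d0) x)) -(fineK (fin_num_measure m _ measurableT)).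
rewrite -(fineK (fin_num_measure (smooth m d0) _ (measurable_itv `]x, +oo[))).
rewrite -(fineK (fin_num_measure m _ (measurable_itv `](x - d)%R, +oo[))).
by rewrite -!EFinD => -[h1] [h2] h3 [h4]; rewrite lee_fin; lra.
Qed.

(** Tonelli transfers the weight from window centres to mass points. Since smoothing moves mass only
    to the right, the left layer keeps its width and the right one grows by [d]. *)
Lemma weighted_mass lam a b d e (d0 : (0 < d)%R) : (0 < e)%R ->
  \int[leb]_x ((weight a b e x)%:E * smooth lam d0 (Ieps e x)) <=
  lam setT + (mcdf lam (a + 2 * e)%R + lam `[(b - 2 * e - d)%R, +oo[%classic).
Proof.
move=> e0.
have mw : measurable_fun setT (fun x => (weight a b e x)%:E : \bar R).
  by apply/measurable_EFinP; exact: measurable_weight.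
have := @tonelli_diff R leb (smooth lam d0) `](- e)%R, e[%classic _ (measurable_itv _) mw.
rewrite (_ : integral leb _ _ = \int[leb]_x ((weight a b e x)%:E * smooth lam d0 (Ieps e x))); last first.
  by apply: eq_integral => x _; rewrite Ieps_diff.
move=> ->; last by move=> x; rewrite lee_fin weight_ge0.
apply: (@le_trans _ _ (\int[smooth lam d0]_t
    (1 + (\1_(`]-oo, (a + 2 * e)%R]) t + \1_(`](b - 2 * e)%R, +oo[) t))%:E)).
  apply: ge0_le_integral_nomeas.
  - by move=> t; apply: integral_ge0 => x _; rewrite lee_fin weight_ge0.
  - by move=> t; exact: weight_window.
have mi (A : set RT) : measurable A -> measurable_fun setT (fun t => (\1_A t)%:E : \bar R).
  by move=> mA; apply/measurable_EFinP; exact: measurable_indic.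
have i0 (A : set RT) t : 0 <= (\1_A t)%:E :> \bar R by rewrite lee_fin.
set A := `]-oo, (a + 2 * e)%R]%classic : set RT; set B := `](b - 2 * e)%R, +oo[%classic : set RT.
have mA : measurable A by exact: measurable_itv.
have mB : measurable B by exact: measurable_itv.
have -> : \int[smooth lam d0]_t (1 + (\1_A t + \1_B t))%:E =
    smooth lam d0 setT + (smooth lam d0 A + smooth lam d0 B).
  under eq_integral do rewrite !EFinD.
  rewrite ge0_integralD//; last 2 first.
  - by move=> t _; rewrite adde_ge0.
  - by apply: emeasurable_funD; exact: mi.
  rewrite integral_cst// mul1e; congr (_ + _).
  rewrite ge0_integralD//; [|exact: mi..].
  by congr (_ + _); (etransitivity; first exact: integral_indic); rewrite setIT.
rewrite smoothT leeD2l//; apply: leeD.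
  have /andP[_] := mcdf_smooth_bounds lam d0 (a + 2 * e)%R.
  by rewrite -lee_fin !fineK ?mcdf_fin.
exact: smooth_tail.
Qed.

(** [lam] plays the variation of the charge with its atoms in [B] deleted; it dominates [p + n] only
    on sets avoiding [B]. *)
Lemma abs_mol_sub_le p n lam (B : seq R) d t : (0 < d)%R ->
  (forall A : set R, measurable A -> (forall q, q \in B -> ~ A q) -> p A + n A <= lam A) ->
  (forall q, q \in B -> ~ (`](t - d)%R, t]%classic q)) ->
  (`|mol p d t - mol n d t| <= mol lam d t)%R.
Proof.
move=> d0 hlam hB; rewrite /mol -mulrBl normrM (ger0_norm (_ : 0 <= d^-1)%R); last first.
  by rewrite invr_ge0 ltW.
rewrite ler_wpM2r ?invr_ge0 ?(ltW d0)//.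
have := hlam _ (measurable_itv `](t - d)%R, t]) hB.
rewrite -![_ `](t - d)%R, t]%classic]/(winm _ d t).
have p0 : (0 <= fine (winm p d t))%R by rewrite fine_ge0// winm_ge0.
have n0 : (0 <= fine (winm n d t))%R by rewrite fine_ge0// winm_ge0.
rewrite -(fineK (winm_fin p d t)) -(fineK (winm_fin n d t)) -(fineK (winm_fin lam d t)).
by rewrite -EFinD lee_fin => h; rewrite ler_norml; apply/andP; split; rewrite /=; lra.
Qed.

(** Outside []q - e, q + e + d[] the point [x] does not feel the atom [q]: every [t] within [e] of
    [x] has a window []t - d, t]] missing [q]. *)
Lemma avg_le p n lam (B : seq R) a b d (d0 : (0 < d)%R) e x :
  (0 < e)%R -> (2 * e < b - a)%R -> I a b x ->
  (forall A : set R, measurable A -> (forall q, q \in B -> ~ A q) -> p A + n A <= lam A) ->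
  (forall q, q \in B -> ~ (`](q - e)%R, (q + e + d)%R[%classic x)) ->
  (avg a b e (fun t => mol p d t - mol n d t)%R x)%:E <=
  (weight a b e x)%:E * smooth lam d0 (Ieps e x).
Proof.
move=> e0 eab Ix hlam hB; have [L [LE L0 Lw]] := leb_IepsI e0 eab Ix.
have mE := measurable_Ieps e x; have mI := measurable_I a b.
have mEI : measurable (Ieps e x `&` I a b) by exact: measurableI.
have fS : smooth lam d0 (Ieps e x) \is a fin_num by exact: fin_num_measure.
have S0 : (0 <= fine (smooth lam d0 (Ieps e x)))%R by rewrite fine_ge0.
have N : \int[leb]_(t in Ieps e x `&` I a b) (`|mol p d t - mol n d t|%R)%:E <=
    smooth lam d0 (Ieps e x).
  rewrite smoothE.
  apply: (@le_trans _ _ (\int[leb]_(t in Ieps e x `&` I a b) (mol lam d t)%:E)).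
    apply: ge0_le_integral => //.
    - apply/measurable_EFinP; apply: measurableT_comp => //; apply: measurable_funTS.
      by apply: measurable_funB; exact: measurable_fun_mol.
    - by apply/measurable_EFinP; apply: measurable_funTS; exact: measurable_fun_mol.
    - move=> t [+ _]; rewrite /Ieps/= in_itv/= lee_fin => /andP[xt tx].
      apply: abs_mol_sub_le hlam _ => // q qB /=; rewrite in_itv/= => /andP[q1 q2].
      by apply: (hB q qB); rewrite /= in_itv/=; apply/andP; split; lra.
  apply: ge0_subset_integral => //.
  - by apply/measurable_EFinP; apply: measurable_funTS; exact: measurable_fun_mol.
  - by move=> t _; rewrite lee_fin mol_ge0.
have N0 : 0 <= \int[leb]_(t in Ieps e x `&` I a b) (`|mol p d t - mol n d t|%R)%:E.
  exact: integral_ge0.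
have Nfin : \int[leb]_(t in Ieps e x `&` I a b) (`|mol p d t - mol n d t|%R)%:E \is a fin_num.
  by rewrite ge0_fin_numE// (le_lt_trans N)// ltey_eq fS.
rewrite /avg LE -(fineK fS) -EFinM lee_fin/= mulrC.
apply: ler_pM => //; first by rewrite invr_ge0 ltW.
  by rewrite fine_ge0.
exact: fine_le.
Qed.

Lemma nonlocal_energy_bound p n lam (B : seq R) a b c0 d (d0 : (0 < d)%R) e :
  (0 < c0)%R -> (0 < e)%R -> (2 * e < b - a)%R ->
  (forall A : set R, measurable A -> (forall q, q \in B -> ~ A q) -> p A + n A <= lam A) ->
  \int[leb]_(x in I a b)
     (fc c0 (e * avg a b e (fun t => mol p d t - mol n d t) x)%R)%:E <=
  (c0 * ((2 * e + d) * (size B)%:R))%:E + (c0 * e)%:E *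
    (lam setT + (mcdf lam (a + 2 * e)%R + lam `[(b - 2 * e - d)%R, +oo[%classic)).
Proof.
move=> c00 e0 eab hlam.
set gd := (fun t => _ - _)%R.
have avg0 x : (0 <= avg a b e gd x)%R.
  by rewrite /avg divr_ge0 ?fine_ge0// integral_ge0.
pose N x : R := (\sum_(q <- B) \1_(`](q - e)%R, (q + e + d)%R[%classic) x)%R.
pose W x : \bar R := (weight a b e x)%:E * smooth lam d0 (Ieps e x).
have N0 x : (0 <= N x)%R by apply: sumr_ge0 => q _; rewrite indicE ler0n.
have W0 x : 0 <= W x by rewrite mule_ge0// lee_fin weight_ge0.
have mN : measurable_fun setT (fun x => (N x)%:E : \bar R).
  by apply/measurable_EFinP; apply: measurable_sum => q; exact: measurable_indic.
have mW : measurable_fun setT W.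
  apply: emeasurable_funM; first by apply/measurable_EFinP; exact: measurable_weight.
  have := @measurable_fun_mass_diff R (smooth lam d0) `](- e)%R, e[%classic (measurable_itv _).
  by apply: eq_measurable_fun => x _; rewrite Ieps_diff.
(* The bounds near [B] and away from it are both nonnegative, so their sum dominates everywhere and
   the domain need not be split. *)
apply: (@le_trans _ _ (\int[leb]_x (c0%:E * (N x)%:E + (c0 * e)%:E * W x))).
  rewrite integral_mkcond; apply: ge0_le_integral_nomeas.
    move=> x; rewrite patchE; case: ifPn => // _.
    by rewrite lee_fin /fc mulr_ge0 ?(ltW c00)// le_min ler01 mulr_ge0// ltW.
  move=> x; rewrite patchE; case: ifPn => [|_]; last first.
    by apply: adde_ge0; apply: mule_ge0 => //; rewrite lee_fin ?mulr_ge0 ?(ltW c00) ?(ltW e0).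
  rewrite inE => Ix.
  have [/hasP[q qB xq]|/hasPn nB] :=
      boolP (has (fun q => x \in `](q - e)%R, (q + e + d)%R[) B).
    apply: (@le_trans _ _ (c0%:E * (N x)%:E)); last first.
      by rewrite leeDl// mule_ge0// lee_fin mulr_ge0// ltW.
    rewrite -EFinM lee_fin /fc ler_pM2l//; apply: (@le_trans _ _ 1%R).
      by rewrite ge_min lexx orbT.
    rewrite /N (big_rem q)//= indicE mem_setE xq lerDl.
    by apply: sumr_ge0 => r _; rewrite indicE ler0n.
  apply: (@le_trans _ _ ((c0 * e)%:E * W x)); last first.
    by rewrite leeDr// -EFinM lee_fin mulr_ge0// ltW.
  apply: (@le_trans _ _ ((c0 * e)%:E * (avg a b e gd x)%:E)).
    by rewrite -EFinM lee_fin /fc -mulrA ler_pM2l// ge_min lexx.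
  apply: lee_wpmul2l; first by rewrite lee_fin mulr_ge0// ltW.
  apply: avg_le hlam _ => // q qB.
  by have := nB q qB => /negP.
have c0E : 0 <= c0%:E :> \bar R by rewrite lee_fin ltW.
have c0e : 0 <= (c0 * e)%:E :> \bar R by rewrite lee_fin mulr_ge0// ltW.
rewrite ge0_integralD//; last 4 first.
- by move=> x _; rewrite mule_ge0// lee_fin.
- exact: measurable_funeM.
- by move=> x _; rewrite mule_ge0.
- exact: measurable_funeM.
rewrite !ge0_integralZl//; last by move=> x _; rewrite lee_fin.
apply: leeD; last by apply: lee_wpmul2l => //; exact: weighted_mass.
rewrite EFinM; apply: lee_wpmul2l => //.
have -> : \int[leb]_x (N x)%:E = \sum_(q <- B) (2 * e + d)%:E.
  under eq_integral do rewrite /N -sumEFin.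
  rewrite ge0_integral_sum//; last first.
    by move=> q; apply/measurable_EFinP; exact: measurable_indic.
  apply: eq_bigr => q _.
  have mq : measurable (`](q - e)%R, (q + e + d)%R[%classic : set RT) by exact: measurable_itv.
  etransitivity; first exact: (integral_indic leb measurableT mq).
  rewrite setIT; etransitivity; first exact: lebesgue_measure_itv.
  by rewrite /= lte_fin ifT; [rewrite -EFinB; congr EFin; lra|lra].
rewrite sumEFin lee_fin big_const_seq count_predT iter_addr_0.
by rewrite mulr_natr.
Qed.

End nonlocal_energy.

(** * The recovery pair at a fixed scale *)

Section recovery.
Context {R : realType}.
Local Notation RT := (measurableTypeR R).
Local Notation leb := (@lebesgue_measure R).
Implicit Types (p n lam : {finite_measure set RT -> \bar R}) (a b d e x : R).
Local Open Scope ereal_scope.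

Lemma mol_jordan (nu : @sm R) d x :
  (mol (jp nu) d x - mol (jn nu) d x = d^-1 * fine (nu `](x - d)%R, x]%classic))%R.
Proof.
rewrite /mol -mulrBl mulrC; congr (_ * _)%R.
have /= -> := jordan_sub nu (measurable_itv `](x - d)%R, x]).
by rewrite fineB//; exact: winm_fin.
Qed.

Lemma L1B a b (f h : R -> R) : L1 a b f -> L1 a b h -> L1 a b (fun x => f x - h x)%R.
Proof.
move=> fL1 hL1; exact: (@integrableB _ _ _ leb _ (measurable_I a b) (EFin \o f) (EFin \o h)).
Qed.

Lemma L1_patch a b (f : R -> R) : L1 a b f ->
  leb.-integrable setT (EFin \o (f \_ (I a b))).
Proof.
by rewrite /L1 integrable_mkcond ?restrict_EFin//; exact: measurable_I.
Qed.

Lemma integral_patch a b (f : R -> R) (A : set R) :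
  \int[leb]_(x in A) ((f \_ (I a b)) x)%:E = \int[leb]_(x in A `&` I a b) (f x)%:E.
Proof.
rewrite integral_mkcondr; apply: eq_integral => x _.
by rewrite !patchE; case: ifPn.
Qed.

(** [Du] and [gamma] share the singular part [Ds]. Mollified with the same kernel, it cancels
    exactly; otherwise its contribution to the L2 term could blow up as [d] tends to 0. *)
Lemma mol_diff a b (Du Ds gamma : @sm R) (u' g : R -> R) d x :
  lebdec a b Du u' Ds -> L1 a b g ->
  (forall A : set R, measurable A ->
     gamma A = Ds A + \int[leb]_(x in A `&` I a b) (g x)%:E) ->
  ((mol (jp Du) d x - mol (jn Du) d x) - (mol (jp gamma) d x - mol (jn gamma) d x) =
   d^-1 * \int[leb]_(t in `](x - d)%R, x]%classic) ((fun x => u' x - g x) \_ (I a b)) t)%R.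
Proof.
move=> [u'L1 [_ [_ DuE]]] gL1 gamE; rewrite !mol_jordan -mulrBr; congr (_ * _)%R.
set W := `](x - d)%R, x]%classic : set RT.
have mI : measurable (I a b : set RT) := measurable_I a b.
have mW : measurable W by exact: measurable_itv.
have mWI : measurable (W `&` I a b) by exact: measurableI.
have iW (f : R -> R) : L1 a b f -> leb.-integrable (W `&` I a b) (EFin \o f).
  by move=> fL1; apply: (integrableS mI) => //; exact: subIsetr.
rewrite /Rintegral integral_patch DuE// gamE//.
have fu := integrable_fin_num mWI (iW _ u'L1).
have fg := integrable_fin_num mWI (iW _ gL1).
rewrite integralB_EFin//; [|exact: iW..].
have fDs : Ds W \is a fin_num by exact: fin_num_measure.
move: fu fg => /= fu fg.
by rewrite (fineD fu fDs) (fineD fDs fg) (fineB fu fg); lra.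
Qed.

Lemma recovery_step a b K c0 (u u' g : R -> R) (gamma Du Ds : @sm R)
    (B : seq R) lam e :
  (a < b)%R -> (0 < c0)%R -> (0 < K)%R ->
  BVder a b u Du -> lebdec a b Du u' Ds -> Linf_bd a b u K -> L1 a b g ->
  (forall A : set R, measurable A ->
     gamma A = Ds A + \int[leb]_(x in A `&` I a b) (g x)%:E) ->
  L2 a b (fun x => u' x - g x)%R ->
  (forall A : set R, measurable A -> (forall q, q \in B -> ~ A q) ->
    jp gamma A + jn gamma A <= lam A) ->
  (0 < e)%R -> (2 * e < b - a)%R ->
  exists (ue : R -> R) (ge : @sm R),
   [/\ \int[leb]_(x in I a b) (`|ue x - u x|)%:E <=
         (e ^+ 2)%:E * (jp Du setT + jn Du setT),
       flatdist a b ge gamma <= (e ^+ 2)%:E * (jp gamma setT + jn gamma setT) &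
       Eeps a b K c0 e ue ge <=
         \int[leb]_(x in I a b) ((u' x - g x) ^+ 2)%:E +
         ((c0 * ((2 + e) * (size B)%:R))%:E + c0%:E *
         (lam setT + (mcdf lam (a + 2 * e)%R + lam `[(b - 2 * e - e ^+ 2)%R, +oo[%classic)))].
Proof.
move=> ab c00 K0 uBV udec uK gL1 gamE [mv v2] hlam e0 eab.
(* With this width each point of [B] costs [c0 * (2 * e + d) / e = c0 * (2 + e)]. *)
have d0 : (0 < e ^+ 2)%R by rewrite exprn_gt0.
set d := (e ^+ 2)%R in d0 *.
have mI : measurable (I a b : set RT) := measurable_I a b.
have [c uE] := BV_repr ab uBV.
have [uL1 [cDu _]] := uBV.
have p0 : mcdf (jp Du) a = 0 by apply: (jp_concentrated cDu) => //; exact: itvNyc_I.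
have n0 : mcdf (jn Du) a = 0 by apply: (jn_concentrated cDu) => //; exact: itvNyc_I.
pose ub := bvfun (jp Du) (jn Du) c.
have ubK : {ae leb, forall x, I a b x -> (`|ub x| <= K)%R}.
  have ae := ae_filter_ringOfSetsType leb.
  by apply: (filterS2 _ _ uE uK) => x h1 h2 Ix; rewrite /ub -h1// h2.
have ubK' := bvfun_left_bd ab ubK p0 n0.
pose ue := bvfun (smooth (jp Du) d0) (smooth (jn Du) d0) c.
pose gd x := (mol (jp gamma) d x - mol (jn gamma) d x)%R.
have gdL1 : L1 a b gd.
  by apply: L1B; apply: (integrableS measurableT) => //; exact: integrable_mol.
(* The density is cut off outside [I a b], since mollification pushes some mass past [b]. *)
pose ge : @sm R := induced_charge (L1_patch gdL1).
have geE (A : set R) : measurable A -> ge A = \int[leb]_(x in A `&` I a b) (gd x)%:E.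
  by move=> mA; rewrite -integral_patch.
exists ue, ge; split.
- apply: le_trans (bvfun_smooth_dist a b (jp Du) (jn Du) c d0).
  rewrite le_eqVlt; apply/orP; left; apply/eqP.
  apply: ae_eq_integral => //.
  + apply/measurable_EFinP; apply: measurableT_comp => //.
    apply: measurable_funB; first exact: measurable_bvfun.
    by apply/measurable_EFinP; exact: measurable_int uL1.
  + apply/measurable_EFinP; apply: measurableT_comp => //.
    by apply: measurable_funB; exact: measurable_bvfun.
  + move: uE; apply: filterS; first exact: (ae_filter_ringOfSetsType leb).
    by move=> x h Ix; rewrite h.
- apply: flatdist_le => // A mA AI.
  rewrite geE// (setIidl AI) !smoothE -integralB_EFin//;
    by apply: (integrableS measurableT) => //; exact: integrable_mol.
- pose up x := (mol (jp Du) d x - mol (jn Du) d x)%R.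
  have mup : measurable_fun setT (fun x => up x - gd x)%R.
    by apply: measurable_funB; apply: measurable_funB; exact: measurable_fun_mol.
  have iv : L1 a b (fun x => u' x - g x)%R by apply: L1B => //; case: udec.
  have L2le : \int[leb]_(x in I a b) ((up x - gd x) ^+ 2)%:E <=
      \int[leb]_(x in I a b) ((u' x - g x) ^+ 2)%:E.
    apply: le_trans (integral_window_sqr d0 (L1_patch iv) (measurable_funTS mup) _) _.
      by move=> x; exact: (mol_diff d x udec gL1 gamE).
    rewrite [leRHS]integral_mkcond le_eqVlt; apply/orP; left; apply/eqP.
    by apply: eq_integral => x _; rewrite !patchE; case: ifPn => //; rewrite expr0n.
  apply: (@le_trans _ _ (\int[leb]_(x in I a b) ((up x - gd x) ^+ 2)%:E
        + e^-1%:E * \int[leb]_(x in I a b) (fc c0 (e * avg a b e gd x))%:E)).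
    apply: ereal_inf_lbound; exists up, gd; split; first exact: W11_bvfun_smooth.
    split.
      apply: aeW => x; rewrite /I/= in_itv/= => /andP[_ xb].
      by apply: bvfun_smooth_bd ubK' xb; exact: ltW.
    split; first exact: gdL1.
    split; first exact: geE.
    split; last by [].
    by split; [exact: measurable_funTS|exact: le_lt_trans L2le v2].
  apply: leeD => //.
  rewrite lee_pdivrMl//.
  apply: le_trans (nonlocal_energy_bound d0 c00 e0 eab hlam) _.
  set X := lam setT + _.
  have X0 : 0 <= X by rewrite /X !adde_ge0// /mcdf.
  have c0E : 0 <= c0%:E * X by rewrite mule_ge0// lee_fin ltW.
  rewrite (ge0_muleDr _ _ c0E); last first.
    by rewrite lee_fin !mulr_ge0 ?(ltW c00)// addr_ge0// ltW.
  rewrite muleA -!EFinM (mulrC e c0); apply: leeD => //.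
  by rewrite lee_fin /d expr2; lra.
Qed.

End recovery.

(** * Passage to the limit *)

Section upper_bound.
Context {R : realType}.
Local Notation RT := (measurableTypeR R).
Local Notation leb := (@lebesgue_measure R).
Implicit Types (p n lam : {finite_measure set RT -> \bar R}) (a b d e x : R).
Local Open Scope ereal_scope.

Lemma cvg_sqr_squeeze (f : R -> \bar R) (C : \bar R) (r : R) : (0 < r)%R ->
  C \is a fin_num ->
  (forall e, (0 < e)%R -> (e < r)%R -> 0 <= f e <= (e ^+ 2)%:E * C) ->
  f @ 0%R^'+ --> 0.
Proof.
move=> r0 Cfin h.
apply: (@squeeze_cvge _ _ _ R (cst 0) f (fun e => (e ^+ 2)%:E * C)); last 2 first.
- exact: cvg_cst.
- rewrite -(fineK Cfin) -[X in _ --> X]/(0%:E).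
  under eq_fun do rewrite -EFinM.
  apply: cvg_EFin; first by apply: nearW.
  rewrite [X in _ --> X](_ : 0%R = (0 ^+ 2 * fine C)%R); last by rewrite expr0n mul0r.
  apply: cvg_at_right_filter; apply: cvgM; last exact: cvg_cst.
  exact: (@exprn_continuous R 2 0%R).
- by near=> e; apply: h; near: e; [exact: nbhs_right_gt|exact: nbhs_right_lt].
Unshelve. all: by end_near. Qed.

Lemma Eupper_le a b K c0 (u u' g : R -> R) (gamma Du Ds : @sm R) (B : seq R) lam :
  (a < b)%R -> (0 < c0)%R -> (0 < K)%R ->
  BVder a b u Du -> lebdec a b Du u' Ds -> Linf_bd a b u K -> L1 a b g ->
  (forall A : set R, measurable A ->
     gamma A = Ds A + \int[leb]_(x in A `&` I a b) (g x)%:E) ->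
  L2 a b (fun x => u' x - g x)%R ->
  (forall A : set R, measurable A -> (forall q, q \in B -> ~ A q) ->
    jp gamma A + jn gamma A <= lam A) ->
  mcdf lam a = 0 -> lam `[b, +oo[%classic = 0 ->
  Eupper a b K c0 u gamma <=
    \int[leb]_(x in I a b) ((u' x - g x) ^+ 2)%:E +
      ((c0 * (2 * (size B)%:R))%:E + c0%:E * lam setT).
Proof.
move=> ab c00 K0 uBV udec uK gL1 gamE v2 hlam lama lamb.
have ba0 : (0 < (b - a) / 2)%R by rewrite divr_gt0// subr_gt0.
pose Q e (z : (R -> R) * @sm R) :=
  [/\ \int[leb]_(x in I a b) (`|z.1 x - u x|)%:E <=
         (e ^+ 2)%:E * (jp Du setT + jn Du setT),
       flatdist a b z.2 gamma <= (e ^+ 2)%:E * (jp gamma setT + jn gamma setT) &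
       Eeps a b K c0 e z.1 z.2 <=
         \int[leb]_(x in I a b) ((u' x - g x) ^+ 2)%:E +
         ((c0 * ((2 + e) * (size B)%:R))%:E + c0%:E *
         (lam setT + (mcdf lam (a + 2 * e)%R + lam `[(b - 2 * e - e ^+ 2)%R, +oo[%classic)))].
have /choice[F FQ] : forall e, exists z, (0 < e)%R -> (e < (b - a) / 2)%R -> Q e z.
  move=> e; have [/andP[e0 eab]|ne] := boolP ((0 < e) && (e < (b - a) / 2))%R; last first.
    (* A default pair for scales outside the admissible range; the limit at [0+] does not see
       them. *)
    by exists (u, gamma) => e0 eab; move: ne; rewrite e0 eab.
  have [|ue [ge [h1 h2 h3]]] := recovery_step ab c00 K0 uBV udec uK gL1 gamE v2 hlam e0.
    lra.
  by exists (ue, ge).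
apply: (@le_trans _ _ (limf_esup (fun e => Eeps a b K c0 e (F e).1 (F e).2) 0%R^'+)).
  apply: ereal_inf_lbound; exists (fun e => (F e).1), (fun e => (F e).2); split.
    apply: (@cvg_sqr_squeeze _ (jp Du setT + jn Du setT) ((b - a) / 2)) => //.
      by rewrite fin_numD !fin_num_measure.
    by move=> e e0 eab; have [h _ _] := FQ e e0 eab; rewrite integral_ge0.
  split=> //.
  apply: (@cvg_sqr_squeeze _ (jp gamma setT + jn gamma setT) ((b - a) / 2)) => //.
    by rewrite fin_numD !fin_num_measure.
  by move=> e e0 eab; have [_ h _] := FQ e e0 eab; rewrite flatdist_ge0.
apply/lee_addgt0Pr => eta eta0.
pose k : R := (size B)%:R.
have k0 : (0 <= k)%R by rewrite ler0n.
(* Three errors share [eta]: the excess [e * k] of the large jumps and the two boundary layers. The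
   choice works because [k + 2 <= 3 * (k + 1)]. *)
pose eta1 := (eta / (3 * c0 * (k + 1)))%R.
have eta10 : (0 < eta1)%R by rewrite divr_gt0// !mulr_gt0// ltr_wpDl.
have eta1k : (c0 * (eta1 * k + (eta1 + eta1)) <= eta)%R.
  have : (eta1 * (3 * c0 * (k + 1)) = eta)%R.
    by rewrite /eta1 divfK// gt_eqF// !mulr_gt0// ltr_wpDl.
  have y0 : (0 < c0 * eta1)%R by rewrite mulr_gt0.
  have : (0 <= c0 * eta1 * k)%R by rewrite mulr_ge0// ltW.
  lra.
have [r1 r10 h1] := mcdf_right_small lama eta10.
have [r2 r20 h2] := mass_left_small lamb eta10.
(* The left layer has width [2 * e], hence [r1 / 2]; the right one has width
   [2 * e + e ^ 2 <= 3 * e] once [e <= 1], hence [r2 / 3]. *)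
pose r := Num.min (Num.min ((b - a) / 2) (Num.min 1 eta1))%R (Num.min (r1 / 2) (r2 / 3))%R.
have r0 : (0 < r)%R by rewrite !lt_min ba0 ltr01 eta10 !divr_gt0.
have [rb r_1 reta rr1 rr2] : [/\ r <= (b - a) / 2, r <= 1, r <= eta1, r <= r1 / 2 & r <= r2 / 3]%R.
  by split; rewrite /r !ge_min lexx ?orbT.
apply: (@le_trans _ _ (ereal_sup [set Eeps a b K c0 e (F e).1 (F e).2 | e in `]0%R, r[%classic])).
  apply: ereal_inf_lbound; exists `]0%R, r[%classic => //.
  near=> e => /=; rewrite in_itv/=; apply/andP; split; near: e;
    [exact: nbhs_right_gt|exact: nbhs_right_lt].
apply: ge_ereal_sup => _ [e /= + <-]; rewrite in_itv/= => /andP[e0 er].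
have eab : (e < (b - a) / 2)%R by exact: lt_le_trans rb.
have [_ _ h3] := FQ e e0 eab.
apply: le_trans h3 _; rewrite -[leRHS]addeA; apply: leeD2l.
have l1 : mcdf lam (a + 2 * e)%R <= eta1%:E.
  by apply: le_trans (ltW h1); apply: le_mcdf; lra.
have l2 : lam `[(b - 2 * e - e ^+ 2)%R, +oo[%classic <= eta1%:E.
  apply: le_trans (ltW h2); apply: le_measure; rewrite ?inE//.
  move=> x /=; rewrite !in_itv/= !andbT; apply: le_trans.
  have : (e ^+ 2 <= e)%R by rewrite expr2 ler_piMr ?(ltW e0)//; lra.
  lra.
move: l1 l2; rewrite -(fineK (mcdf_fin lam _)).
rewrite -(fineK (fin_num_measure lam _ (measurable_itv `[(b - 2 * e - e ^+ 2)%R, +oo[))).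
rewrite -(fineK (fin_num_measure lam _ measurableT)).
rewrite -!(EFinD, EFinM) !lee_fin -/k => l1 l2.
have : (e * k <= eta1 * k)%R by apply: ler_wpM2r => //; lra.
move: eta1k; nra.
Unshelve. all: by end_near. Qed.

End upper_bound.

(** * The variation of [gamma] on and off the jump set *)

Section variation.
Context {R : realType}.
Local Notation RT := (measurableTypeR R).
Local Notation leb := (@lebesgue_measure R).
Implicit Types (nu : @sm R) (x : R).
Local Open Scope ereal_scope.

Definition varm nu : {measure set RT -> \bar R} := measure_add (jp nu) (jn nu).

Lemma varmE nu (A : set R) : varm nu A = jp nu A + jn nu A.
Proof. by rewrite /varm/= /measure_add/= /msum !big_ord_recl big_ord0 adde0. Qed.

Lemma varm_lty nu (A : set R) : measurable A -> varm nu A < +oo.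
Proof.
by move=> mA; rewrite varmE ltey_eq fin_numD !fin_num_measure.
Qed.

(** A point lies in only one of the two Hahn sets, so one Jordan part gives it no mass. *)
Lemma varm_set1 nu x : varm nu [set x] = `|nu [set x]|.
Proof.
have m1 : measurable ([set x] : set RT) by exact: measurable_set1.
rewrite varmE jpE// jnE//.
have [[_ posP] [_ negN] PN PN0] := hahnH nu.
have [Px|Nx] : hahnP nu x \/ hahnN nu x.
  by have : (hahnP nu `|` hahnN nu) x by rewrite PN.
- have -> : [set x] `&` hahnP nu = [set x].
    by apply/seteqP; split => y //= [] // ->.
  have -> : [set x] `&` hahnN nu = set0.
    by apply/seteqP; split => y //= [-> Nx]; have : (hahnP nu `&` hahnN nu) x by []; rewrite PN0.
  rewrite charge0 oppe0 adde0 gee0_abs//; apply: posP => //.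
  by move=> y ->.
- have -> : [set x] `&` hahnN nu = [set x].
    by apply/seteqP; split => y //= [] // ->.
  have -> : [set x] `&` hahnP nu = set0.
    by apply/seteqP; split => y //= [-> Px]; have : (hahnP nu `&` hahnN nu) x by []; rewrite PN0.
  rewrite charge0 add0e lee0_abs//; apply: negN => //.
  by move=> y ->.
Qed.

Lemma finite_set_measurable (A : set R) : finite_set A -> measurable (A : set RT).
Proof.
move=> fA; apply: (@countable_measurable _ RT); last exact: finite_set_countable.
by move=> t; exact: measurable_set1.
Qed.

Lemma measure_uniq_seq (m : {measure set RT -> \bar R}) (s : seq R) : uniq s ->
  m [set` s] = \sum_(x <- s) m [set x].
Proof.
elim: s => [_|x s ih /= /andP[xs us]].
  by rewrite big_nil (_ : [set` [::]] = set0) ?measure0//; apply/seteqP; split.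
have mseq (t : seq R) : measurable ([set` t] : set RT).
  by apply: finite_set_measurable; exact: finite_seq.
rewrite big_cons -ih// -measureU//; last first.
  by apply/seteqP; split => y //= [-> ]; rewrite (negbTE xs).
congr (m _); apply/seteqP; split => y /=; rewrite inE.
  by move=> /orP[/eqP->|]; [left|right].
by case=> [->|->]; rewrite ?eqxx ?orbT.
Qed.

Lemma finite_heavy_atoms nu (r : R) : (0 < r)%R ->
  finite_set [set x | r%:E <= varm nu [set x]].
Proof.
move=> r0; apply: contrapT => inf.
have vfin : varm nu setT \is a fin_num by rewrite ge0_fin_numE// varm_lty.
(* One more point than the finite total variation can carry at mass [r] each. *)
pose k := (Num.truncn (fine (varm nu setT) / r)).+1.
have [s sA ks] := infinite_set_fset k inf.
have /measure_uniq_seq e : uniq (finmap.enum_fset s) by exact: finmap.fset_uniq.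
have : (k%:R * r)%:E <= varm nu setT.
  apply: (@le_trans _ _ (varm nu [set` finmap.enum_fset s])); last first.
    apply: le_measure; rewrite ?inE//.
    by apply: finite_set_measurable; exact: finite_seq.
  rewrite e; apply: (@le_trans _ _ (\sum_(x <- finmap.enum_fset s) r%:E)).
    rewrite sumEFin lee_fin big_const_seq count_predT iter_addr_0 -[leRHS]mulr_natl.
    by rewrite ler_pM2r// ler_nat.
  rewrite !big_seq; apply: lee_sum => x xs; exact: (sA x).
rewrite -(fineK vfin) lee_fin leNgt -ltr_pdivrMr//.
by rewrite truncnS_gt.
Qed.

Section decomposition.
Variables (a b : R) (Du Ds gamma : @sm R) (u' g : R -> R).
Hypothesis udec : lebdec a b Du u' Ds.
Hypothesis cDu : concentrated a b Du.
Hypothesis gL1 : L1 a b g.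
Hypothesis gamE : forall A : set R, measurable A ->
  gamma A = Ds A + \int[leb]_(x in A `&` I a b) (g x)%:E.

Local Notation J := (jumpset a b Du).

Lemma concentrated_gamma : concentrated a b gamma.
Proof.
have [_ [cDs _]] := udec; have mI := measurable_I a b.
by move=> A mA; rewrite !gamE//; [rewrite -cDs// -setIA setIid|exact: measurableI].
Qed.

Lemma gamma_set1 x : gamma [set x] = Du [set x].
Proof.
have [_ [_ [_ DuE]]] := udec.
have int0 (f : R -> R) : \int[leb]_(x in [set x] `&` I a b) (f x)%:E = 0.
  by apply: (@integral_Sset1 _ _ _ x); exact: subIsetl.
rewrite gamE ?DuE; [|exact: measurable_set1..].
by rewrite !int0 add0e adde0.
Qed.

(** Exhausts the jump set by finite sets. This gives its measurability, and a comparison of the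
    variation on it with finite partial sums. *)
Lemma jumpsetE : J = \bigcup_n [set x | (n.+1%:R^-1)%:E <= varm gamma [set x]].
Proof.
apply/seteqP; split => [x [Ix Dux]|x [n _ /=]]; last first.
  rewrite varm_set1 gamma_set1 => h; split; last first.
    by apply/eqP => D0; move: h; rewrite D0 abse0 leNgt lte_fin invr_gt0 ltr0n.
  apply: contrapT => nIx; move: h; rewrite cDu; last exact: measurable_set1.
  rewrite (_ : [set x] `&` I a b = set0).
    by rewrite charge0 abse0 leNgt lte_fin invr_gt0 ltr0n.
  by apply/seteqP; split => y //= [->].
have fD : Du [set x] \is a fin_num by apply: fin_num_measure; exact: measurable_set1.
have D0 : (0 < `|fine (Du [set x])|)%R by rewrite normr_gt0 fine_eq0.
exists (Num.truncn (`|fine (Du [set x])|)^-1) => //=.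
rewrite varm_set1 gamma_set1 -(fineK fD) abse_EFin lee_fin ltW//.
by rewrite invf_plt ?posrE// truncnS_gt.
Qed.

Lemma measurable_jumpset : measurable (J : set RT).
Proof.
rewrite jumpsetE; apply: bigcupT_measurable => n; apply: finite_set_measurable.
exact: finite_heavy_atoms.
Qed.

(** On each finite piece the variation is a sum over atoms, bounded termwise and hence by the full
    [\esum]; continuity from below then reaches [J] minus [B]. *)
Lemma varm_jumps_le (B : set R) (w : R -> \bar R) (k : R) : measurable (B : set RT) -> (0 < k)%R ->
  (forall x, J x -> 0 <= w x) ->
  (forall x, J x -> ~ B x -> varm gamma [set x] <= k%:E * w x) ->
  varm gamma (J `\` B) <= k%:E * \esum_(x in J `&` ~` B) w x.
Proof.
move=> mB k0 w0 hw.
pose E (n : nat) := [set x | (n.+1%:R^-1)%:E <= varm gamma [set x]] `\` B.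
have fE n : finite_set (E n) by apply: finite_setD; exact: finite_heavy_atoms.
have mE n : measurable (E n : set RT) by exact: finite_set_measurable.
have EJ : J `\` B = \bigcup_n E n by rewrite jumpsetE setD_bigcupl.
have : varm gamma \o E @ \oo --> varm gamma (\bigcup_n E n).
  apply: nondecreasing_cvg_mu => //; first exact: bigcupT_measurable.
  move=> n m nm; apply/subsetPset => x [/= h nB]; split => //=; apply: le_trans h.
  by rewrite lee_fin lef_pV2 ?posrE// ler_nat.
rewrite -EJ => /cvge_to_le; apply; apply: nearW => n /=.
have <- : [set` finmap.enum_fset (fset_set (E n))] = E n by exact: fset_setK.
rewrite measure_uniq_seq; last exact: finmap.fset_uniq.
have EnJ x : x \in finmap.enum_fset (fset_set (E n)) -> J x /\ ~ B x.
  move=> xE; have : (\bigcup_n E n) x.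
    have : x \in E n by rewrite -(in_fset_set (fE n)).
    by rewrite inE => Enx; exists n.
  by rewrite -EJ => -[].
apply: (@le_trans _ _ (\sum_(x <- finmap.enum_fset (fset_set (E n))) k%:E * w x)).
  rewrite !big_seq; apply: lee_sum => x /EnJ[Jx nB]; exact: hw.
rewrite big_seq -ge0_sume_distrr; last by move=> x /EnJ[Jx nB]; exact: w0.
apply: lee_wpmul2l; first by rewrite lee_fin ltW.
apply: esum_ge; exists (E n); last by rewrite fsbig_finite// big_seq.
split => // x Enx; have : (\bigcup_n E n) x by exists n.
by rewrite -EJ => -[].
Qed.

(** The variation is [gamma] of the positive Hahn set minus [gamma] of the negative one. Off the
    jumps, the parts carried by [g] and by [Ds] are bounded separately along this partition. *)
Lemma varm_diffuse_le : varm gamma (~` J) <=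
  \int[leb]_(x in I a b) (`|g x|)%:E + tv (cantor_part a b Du Ds) (I a b).
Proof.
have [u'L1 [cDs _]] := udec.
have mI : measurable (I a b : set RT) := measurable_I a b.
have mJ := measurable_jumpset; have mJC : measurable (~` J : set RT) by exact: measurableC.
have mP := measurable_hahnP gamma; have mN := measurable_hahnN gamma.
have [_ _ _ PN0] := hahnH gamma.
have mJP : measurable (~` J `&` hahnP gamma : set RT) by exact: measurableI.
have mJN : measurable (~` J `&` hahnN gamma : set RT) by exact: measurableI.
rewrite varmE jpE// jnE// !gamE//.
set P := ~` J `&` hahnP gamma; set N := ~` J `&` hahnN gamma.
have mPI : measurable (P `&` I a b : set RT) by exact: measurableI.
have mNI : measurable (N `&` I a b : set RT) by exact: measurableI.
have iPI : leb.-integrable (P `&` I a b) (EFin \o g).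
  by apply: (integrableS mI) => //; exact: subIsetr.
have iNI : leb.-integrable (N `&` I a b) (EFin \o g).
  by apply: (integrableS mI) => //; exact: subIsetr.
have fP := integrable_fin_num mPI iPI; have fN := integrable_fin_num mNI iNI.
have fDP : Ds P \is a fin_num by exact: fin_num_measure.
have fDN : Ds N \is a fin_num by exact: fin_num_measure.
have h1 : \int[leb]_(x in P `&` I a b) (g x)%:E - \int[leb]_(x in N `&` I a b) (g x)%:E <=
    \int[leb]_(x in I a b) (`|g x|)%:E.
  have mg (A : set RT) : A `<=` I a b -> measurable A -> measurable_fun A (EFin \o g).
    by move=> AI mA; apply: (measurable_funS mI AI); exact: measurable_int gL1.
  have mag (A : set RT) : A `<=` I a b -> measurable A ->
      measurable_fun A (fun x => (`|g x|)%:E : \bar R).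
    move=> AI mA; apply/measurable_EFinP; apply: measurableT_comp => //.
    by apply/measurable_EFinP; exact: mg.
  have le1 (A : set RT) : A `<=` I a b -> measurable A ->
      `|\int[leb]_(x in A) (g x)%:E| <= \int[leb]_(x in A) (`|g x|)%:E.
    by move=> AI mA; have := le_abse_integral leb mA (mg A AI mA).
  have PI := @subIsetr _ P (I a b); have NI := @subIsetr _ N (I a b).
  apply: (@le_trans _ _ (\int[leb]_(x in P `&` I a b) (`|g x|)%:E +
      \int[leb]_(x in N `&` I a b) (`|g x|)%:E)).
    apply: leeD; first exact: le_trans (lee_abs _) (le1 _ PI mPI).
    by apply: le_trans (le1 _ NI mNI); rewrite -abseN; exact: lee_abs.
  have UI : P `&` I a b `|` N `&` I a b `<=` I a b by move=> x [[]|[]].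
  have mU : measurable (P `&` I a b `|` N `&` I a b : set RT) by exact: measurableU.
  rewrite -ge0_integral_setU//.
  - by apply: ge0_subset_integral => //; exact: mag.
  - exact: mag.
  - apply/disj_setPS => x [[[_ Px] _] [[_ Nx] _]].
    by have : (hahnP gamma `&` hahnN gamma) x by []; rewrite PN0.
have h2 : Ds P - Ds N <= tv (cantor_part a b Du Ds) (I a b).
  (* A lower bound for the supremum [tv] needs a single competitor: the two Hahn sets of [gamma],
     padded with empty sets. *)
  pose A (i : nat) : set R := match i with
    | 0%N => I a b `&` hahnP gamma | 1%N => I a b `&` hahnN gamma | _ => set0 end.
  have mA i : measurable (A i : set RT).
    by case: i => [|[|i]] /=; [exact: measurableI|exact: measurableI|exact: measurable0].
  have AI i : A i `<=` I a b.
    by case: i => [|[|i]] /=; [exact: subIsetl|exact: subIsetl|exact: sub0set].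
  have disj : (I a b `&` hahnP gamma) `&` (I a b `&` hahnN gamma) = set0.
    by rewrite setIACA setIid PN0 setI0.
  apply: (@le_trans _ _ (\sum_(i < 2) `|cantor_part a b Du Ds (A i)|)); last first.
    apply: ereal_sup_ubound; exists 2%N, A; split; first by move=> i; split; [exact: mA|exact: AI].
    by split=> // -[|[|i]] [|[|j]] //= _; rewrite ?set0I ?setI0// setIC.
  rewrite big_ord_recl big_ord_recl big_ord0 adde0/= /cantor_part.
  have -> : I a b `&` hahnP gamma `\` J = P `&` I a b.
    by rewrite setDE /P setIC setIA setIAC.
  have -> : I a b `&` hahnN gamma `\` J = N `&` I a b.
    by rewrite setDE /N setIC setIA setIAC.
  rewrite -!cDs//; apply: leeD; first exact: lee_abs.
  by rewrite -abseN; exact: lee_abs.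
apply: le_trans (leeD h1 h2).
rewrite -(fineK fDP) -(fineK fDN) -(fineK fP) -(fineK fN).
by rewrite -!(EFinN, EFinD) lee_fin; lra.
Qed.

End decomposition.
End variation.

(** * Matching the bound with the limit energy *)

Lemma adde_shuffle (R : realType) (V k G T S : \bar R) :
  (V + (k + (G + T + S)) = V + G + (k + S) + T)%E.
Proof.
by rewrite -!addeA (addeCA k G) (addeC T).
Qed.

Lemma Eupper_le_admissible (R : realType) (a b K c0 : R) (u u' g : R -> R)
    (gamma Du Ds : @sm R) :
  0 < c0 -> 0 < K -> a < b ->
  BVder a b u Du -> lebdec a b Du u' Ds -> Linf_bd a b u K -> L1 a b g ->
  (forall A : set R, measurable A ->
     gamma A = Ds A + \int[lebesgue_measure]_(x in A `&` I a b) (g x)%:E)%E ->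
  L2 a b (fun x => u' x - g x) ->
  (Eupper a b K c0 u gamma <=
    \int[lebesgue_measure]_(x in I a b) ((u' x - g x) ^+ 2)%:E
    + c0%:E * \int[lebesgue_measure]_(x in I a b) (`|g x|)%:E
    + 2%:E * (\esum_(x in jumpset a b Du) (fc c0 (`|fine (Du [set x])| / 2))%:E)
    + c0%:E * tv (cantor_part a b Du Ds) (I a b))%E.
Proof.
move=> c00 K0 ab uBV udec uK gL1 gamE v2.
have [_ [cDu _]] := uBV.
have cgam := concentrated_gamma udec gamE.
pose J := jumpset a b Du.
(* Size 2 is where [fc c0 (t / 2)] reaches its maximum [c0]. *)
pose big := J `&` [set x | 2 <= `|fine (Du [set x])|].
have fDu x : (Du [set x] \is a fin_num)%E by apply: fin_num_measure; exact: measurable_set1.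
have varD x : varm gamma [set x] = `|fine (Du [set x])|%:E.
  by rewrite varm_set1 (gamma_set1 udec gamE) -{1}(fineK (fDu x)) abse_EFin.
have fbig : finite_set big.
  apply: sub_finite_set (finite_heavy_atoms gamma (ltr0Sn R 1)) => x [_ /=].
  by rewrite varD lee_fin.
have mbig : measurable (~` big : set (measurableTypeR R)).
  by apply: measurableC; exact: finite_set_measurable.
(* The variation of [gamma] with the large jumps deleted. *)
pose lam : {finite_measure set (measurableTypeR R) -> \bar R} :=
  mfrestr mbig (varm_lty gamma mbig).
have lamE (A : set R) : lam A = varm gamma (A `&` ~` big) by [].
pose s := finmap.enum_fset (fset_set big).
have sE x : (x \in s) = (x \in big) := in_fset_set fbig x.
have lam0 (A : set R) : measurable A -> A `&` I a b = set0 -> (lam A = 0)%E.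
  move=> mA A0; have mAB : measurable (A `&` ~` big : set (measurableTypeR R)).
    exact: measurableI.
  have AB0 : (A `&` ~` big) `&` I a b = set0 by rewrite setIAC A0 set0I.
  by rewrite lamE varmE (jp_concentrated cgam mAB AB0) (jn_concentrated cgam mAB AB0) adde0.
have hlam (A : set R) : measurable A -> (forall q, q \in s -> ~ A q) ->
    (jp gamma A + jn gamma A <= lam A)%E.
  move=> mA AB; rewrite lamE -varmE (_ : A `&` ~` big = A)//.
  by apply/setIidl => x Ax /= bx; apply: (AB x) => //; rewrite sE inE.
apply: le_trans (Eupper_le ab c00 K0 uBV udec uK gL1 gamE v2 hlam _ _) _.
- by apply: lam0 => //; exact: itvNyc_I.
- by apply: lam0 => //; exact: itvcy_I.
have mJ := measurable_jumpset udec cDu gamE.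
have fc0 x : (0 <= (fc c0 (`|fine (Du [set x])| / 2))%:E)%E.
  by rewrite lee_fin /fc mulr_ge0 ?(ltW c00)// le_min ler01 divr_ge0.
set G := (\int[lebesgue_measure]_(x in I a b) (`|g x|)%:E)%E.
set T := tv _ _.
have T0 : (0 <= T)%E.
  apply: ereal_sup_ubound; exists 0%N, (fun=> set0); split; first by move=> i; split.
  by split; [move=> i j _; rewrite set0I|rewrite big_ord0].
have G0 : (0 <= G)%E by apply: integral_ge0 => x _; rewrite lee_fin.
pose S2 := (\esum_(x in J `&` ~` big) (fc c0 (`|fine (Du [set x])| / 2))%:E)%E.
have S20 : (0 <= S2)%E by apply: esum_ge0.
(* For a jump of size [t < 2] one has [fc c0 (t / 2) = c0 * t / 2], so [t] is [2 / c0] times its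
   energy term; multiplied by [c0] this restores the factor 2 of the limit energy. *)
have small : (varm gamma (J `\` big) <= (2 / c0)%:E * S2)%E.
  apply: (varm_jumps_le udec cDu gamE) => //.
  - exact: finite_set_measurable.
  - by rewrite divr_gt0.
  - move=> x Jx nbx; rewrite varD -EFinM lee_fin /fc.
    have t2 : `|fine (Du [set x])| < 2.
      by rewrite ltNge; apply/negP => h; apply: nbx; split.
    have -> : Num.min (`|fine (Du [set x])| / 2) 1 = `|fine (Du [set x])| / 2.
      by apply/min_idPl; lra.
    by rewrite mulrA divfK ?gt_eqF// mulrCA divff// mulr1.
have lamT : (lam setT <= (G + T) + (2 / c0)%:E * S2)%E.
  rewrite lamE setTI.
  have -> : ~` big = ~` J `|` (J `\` big).
    apply/seteqP; split => x /=.
      by move=> nb; have [Jx|nJ] := pselect (J x); [right|left].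
    by move=> [nJ [/nJ]|[]].
  apply: le_trans (measureU2 _ _ _) _.
  - exact: measurableC.
  - by apply: measurableD => //; exact: finite_set_measurable.
  apply: leeD small; exact: (varm_diffuse_le udec cDu gL1 gamE).
(* Every large jump contributes exactly [c0], so twice this sum is the cost paid near [B]. *)
have S1 : (\esum_(x in J `&` big) (fc c0 (`|fine (Du [set x])| / 2))%:E = (c0 * (size s)%:R)%:E)%E.
  have -> : J `&` big = big by rewrite /big setIA setIid.
  rewrite (eq_esum (b := fun=> c0%:E)); last first.
    move=> x [_ /= h]; rewrite /fc; congr EFin.
    by have /min_idPr -> : 1 <= `|fine (Du [set x])| / 2; [lra|rewrite mulr1].
  rewrite esum_fset//; last by move=> x _; rewrite lee_fin ltW.
  rewrite fsbig_finite// -/s sumEFin big_const_seq count_predT iter_addr_0.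
  by rewrite mulr_natr.
rewrite (@esumID _ _ big)// -/J -/S2 S1.
have -> : (2%:E * ((c0 * (size s)%:R)%:E + S2) = (c0 * (2 * (size s)%:R))%:E + 2%:E * S2)%E.
  rewrite ge0_muleDr//; last by rewrite lee_fin mulr_ge0// ltW.
  by rewrite -EFinM mulrCA.
have : (c0%:E * lam setT <= c0%:E * G + c0%:E * T + 2%:E * S2)%E.
  apply: (@le_trans _ _ (c0%:E * ((G + T) + (2 / c0)%:E * S2))%E).
    by apply: lee_wpmul2l => //; rewrite lee_fin ltW.
  have cS0 : (0 <= (2 / c0)%:E * S2)%E by rewrite mule_ge0// lee_fin divr_ge0// ltW.
  rewrite (ge0_muleDr _ (adde_ge0 G0 T0) cS0) (ge0_muleDr _ G0 T0) muleA -EFinM.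
  by rewrite (_ : c0 * (2 / c0) = 2)// mulrCA divff ?mulr1// gt_eqF.
set V := (\int[lebesgue_measure]_(x in I a b) ((u' x - g x) ^+ 2)%:E)%E.
move=> h; set k := (c0 * _)%:E.
apply: (@le_trans _ _ (V + (k + (c0%:E * G + c0%:E * T + 2%:E * S2)))%E).
  by apply: leeD2l; apply: leeD2l.
rewrite le_eqVlt; apply/orP; left; apply/eqP.
exact: adde_shuffle.
Qed.

Theorem mainTheorem14 (R : realType) (a b K c0 : R)
  (u : R -> R) (gamma : sm) (Du : sm) (u' : R -> R) (Ds : sm) (g : R -> R) :
  0 < a -> a < b -> 0 < c0 -> 0 < K ->
  BVder a b u Du -> lebdec a b Du u' Ds ->
  Linf_bd a b u K ->
  L1 a b g ->
  (forall A : set R, measurable A ->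
     gamma A = (Ds A + \int[lebesgue_measure]_(x in A `&` I a b) (g x)%:E)%E) ->
  L2 a b (fun x => u' x - g x) ->
  (Eupper a b K c0 u gamma <= Elim a b K c0 u gamma)%E.
Proof.
(* [Elim] is an infimum over all admissible decompositions of the pair, so the bound is proved for
   each of them. *)
move=> _ ab c00 K0 _ _ _ _ _ _; apply/ereal_infP => v [Du1 [u1 [Ds1 [g1]]]].
move=> [uBV [udec [uK [gL1 [gamE [v2 ->]]]]]].
exact: Eupper_le_admissible.
Qed.
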